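(* Let $(\Omega,\mathcal F,\mathbb P)$ be an atomless probability space, let $p\in(0,1)$, $q\in[1,\infty)$, and let $\rho:L^q\to\mathbb R$ be a risk measure that is continuous with respect to the norm $\|X\|_q=(\mathbb E[|X|^q])^{1/q}$. Then $\rho$ satisfies [M], [TI], [$p$-CA] and $\rho(0)=0$ if and only if it has the form $$\rho(X)=g(\mathrm{ES}_p(X)-\mathbb E[X])+\mathbb E[X],\qquad X\in L^q,$$ for some increasing and $1$-Lipschitz function $g:[0,\infty)\to\mathbb R$ with $g(0)=0$. In particular, any such $\rho$ is a consistent risk measure.
   Context: $(\Omega,\mathcal F,\mathbb P)$ is atomless; $L^q$ is the space of random variables $X$ with $\mathbb E[|X|^q]<\infty$. A risk measure is simply a functional on this space. ''Increasing'' means non-strictly increasing; $g$ is $1$-Lipschitz if $|g(x)-g(y)|\le|x-y|$ for all $x,y\ge0$. $X\overset{d}{=}Y$ means equality in law. For $p\in(0,1)$, $\mathrm{VaR}_p(X)=\inf\{x\in\mathbb R:\mathbb P(X\le x)\ge p\}$ and $\mathrm{ES}_p(X)=\frac1{1-p}\int_p^1\mathrm{VaR}_s(X)\,ds$. A tail event of a random variable $X$ is an event $A\in\mathcal F$ with $0<\mathbb P(A)<1$ such that $X(\omega)\ge X(\omega')$ for a.s. all $\omega\in A$ and $\omega'\in A^c$. A $p$-tail event of $X$ is a tail event of $X$ with probability $1-p$. A random vector is $p$-concentrated if its components share a common $p$-tail event. [M]: $\rho(X)\le\rho(Y)$ whenever $X\le Y$ pointwise. [TI]: $\rho(X+c)=\rho(X)+c$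 for all $X$ and all $c\in\mathbb R$. [$p$-CA]: $\rho(X+Y)\le\rho(X'+Y')$ for all $X,Y,X',Y'\in L^q$ such that $(X',Y')$ is $p$-concentrated, $X\overset{d}{=}X'$ and $Y\overset{d}{=}Y'$. A consistent risk measure is a risk measure satisfying [M], [TI] and SSD-consistency: $\rho(X)\le\rho(Y)$ whenever $\mathbb E[u(X)]\le\mathbb E[u(Y)]$ for all increasing convex functions $u:\mathbb R\to\mathbb R$ (expectations being allowed to equal $+\infty$). *)

(* Defs.v *)
From HB Require Import structures.
From mathcomp Require Import all_boot all_order all_algebra.
From mathcomp Require Import all_classical all_reals all_analysis.

Set Implicit Arguments.
Unset Strict Implicit.
Unset Printing Implicit Defensive.

Import Order.TTheory GRing.Theory Num.Theory.
Import numFieldNormedType.Exports.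

Local Open Scope classical_set_scope.
Local Open Scope ring_scope.

Section random_variables.
Context {d : measure_display} {T : measurableType d} {R : realType}.
Variable P : probability T R.

Definition atomless : Prop :=
  forall A : set T, measurable A -> (0 < P A)%E ->
    exists B : set T, [/\ measurable B, B `<=` A & (0 < P B < P A)%E].

(* A measure is only constrained on measurable sets, so the laws are compared
   on Borel sets rather than by equality of set functions. *)
Definition equal_in_law (X Y : {RV P >-> R}) : Prop :=
  forall B : set R, measurable B -> distribution P X B = distribution P Y B.

Definition VaR (s : R) (X : T -> R) : R :=
  inf [set x : R | (s%:E <= P [set w | X w <= x]%R)%E].

(* The interval is open because VaR is only meant for levels in (0, 1): the set
   defining it may be empty at level 1. *)
Definition ES (p : R) (X : T -> R) : R :=
  (1 - p)^-1 * \int[lebesgue_measure]_(s in `]p, 1[) VaR s X.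

Definition mean (X : T -> R) : R := fine 'E_P[X]%E.

(* "For a.s. all w in A and w' outside A" is read as an iterated almost sure
   quantification; by Fubini this agrees with the product measure reading. *)
Definition tail_event (X : T -> R) (A : set T) : Prop :=
  [/\ measurable A, (0 < P A < 1)%E &
      {ae P, forall w, A w -> {ae P, forall w', ~ A w' -> X w' <= X w}}].

Definition p_tail_event (p : R) (X : T -> R) (A : set T) : Prop :=
  tail_event X A /\ P A = (1 - p)%:E.

Definition p_concentrated (p : R) (X Y : T -> R) : Prop :=
  exists A : set T, p_tail_event p X A /\ p_tail_event p Y A.

End random_variables.
Arguments equal_in_law {d T R} P X Y.

(* [LfunType P q1] is the space of random variables (functions, not classes
   modulo almost sure equality) with finite q-norm. *)
Section risk_measures.
Context {d : measure_display} {T : measurableType d} {R : realType}.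
Context {P : probability T R} {q : R} {q1 : (1 <= q%:E)%E}.
Local Notation Lq := (LfunType P q1).
Implicit Types (rho : Lq -> R) (X Y : Lq).

Lemma cst_Lfun (c : R) : (cst c : T -> R) \in Lfun P q%:E.
Proof. exact: Lfun_cst. Qed.

Definition Lq_cst (c : R) : Lq := Lfun_Sub q1 (cst_Lfun c).

Definition Lq_continuous rho : Prop :=
  forall X (e : R), 0 < e -> exists2 delta : R, 0 < delta &
    forall Y, ('N[P]_(q%:E)[EFin \o (Y - X)%R] < delta%:E)%E ->
      `|rho Y - rho X| < e.

Definition monotone_risk rho : Prop :=
  forall X Y, (forall w, X w <= Y w) -> rho X <= rho Y.

Definition translation_invariant rho : Prop :=
  forall X (c : R), rho (X + Lq_cst c) = rho X + c.

Definition concentration_averse (p : R) rho : Prop :=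
  forall X Y X' Y' : Lq, p_concentrated P p X' Y' ->
    equal_in_law P X X' -> equal_in_law P Y Y' ->
    rho (X + Y) <= rho (X' + Y').

Definition SSD_consistent rho : Prop :=
  forall X Y,
    (forall u : R -> R, {homo u : x y / x <= y} ->
       convex_function [set: R^o] u -> ('E_P[u \o X] <= 'E_P[u \o Y])%E) ->
    rho X <= rho Y.

Definition consistent_risk rho : Prop :=
  [/\ monotone_risk rho, translation_invariant rho & SSD_consistent rho].

(* A function [0, +oo) -> R is encoded by a function on R whose values at
   negative reals are irrelevant, as ES p X >= E[X]. *)
Definition mean_ES_form (p : R) rho : Prop :=
  exists g : R -> R,
    [/\ {in `[0, +oo[ &, {homo g : x y / x <= y}},
        {in `[0, +oo[ &, forall x y, `|g x - g y| <= `|x - y|},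
        g 0 = 0 &
        forall X, rho X = g (ES P p X - mean P X) + mean P X].

End risk_measures.

(* Main.v *)
Require Import Defs.
From mathcomp Require Import all_boot all_order all_algebra.
From mathcomp Require Import all_classical all_reals all_analysis.
From mathcomp Require Import measurable_realfun lra ring.

(* Write v for VaR_p(X). By the layer-cake formula,
   (1 - p) ES_p(X) = (1 - p) v + E[(X - v)^+], and as P is atomless X has a
   tail event A of probability 1 - p on which X >= v and off which X <= v. So
   (1 - p) ES_p(X) = E[X 1_A] is the maximum of E[X 1_B] over P(B) = 1 - p,
   which yields every property of ES_p needed for the "if" part and for
   consistency.
   For the "only if" part, let A be a p-tail event of X. Concentration aversion
   used in both directions shows that, in a sum of variables which all have A as
   a tail event, a summand can be replaced by any other one with the same law.
   Moving pieces s 1_B around inside A or inside its complement (s >= 0, resp.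
   s <= 0), in halves, replaces X by its conditional mean given A: first for
   simple functions, because rho is 1-Lipschitz for the sup norm by [M] and
   [TI], and then in general by L^q-continuity. So rho(X) is determined by E[X]
   and ES_p(X), through the profile c |-> rho(c 1_A). The profile is increasing
   and 1-Lipschitz; comparing c 1_A + delta 1_B, for B independent of A, with
   (c + delta) 1_A shows that its slope is at least 1 - p. *)

Set Implicit Arguments.
Unset Strict Implicit.
Unset Printing Implicit Defensive.

Import Order.TTheory GRing.Theory Num.Theory.
Import numFieldNormedType.Exports.

Local Open Scope classical_set_scope.
Local Open Scope ring_scope.

(** * Real-valued probabilities and Sierpinski's theorem for atomless spaces *)

Section real_probability.
Context {d : measure_display} {T : measurableType d} {R : realType}.
Variable P : probability T R.

Definition pr (A : set T) : R := fine (P A).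

Lemma prE A : measurable A -> P A = (pr A)%:E.
Proof. by move=> mA; rewrite fineK// fin_num_measure. Qed.

Lemma pr_ge0 A : 0 <= pr A.
Proof. exact: fine_ge0. Qed.

Lemma pr_set0 : pr set0 = 0.
Proof. by rewrite /pr measure0. Qed.

Lemma prT : pr [set: T] = 1.
Proof. by rewrite /pr probability_setT. Qed.

Lemma le_pr A B : measurable A -> measurable B -> A `<=` B -> pr A <= pr B.
Proof.
by move=> mA mB AB; rewrite -lee_fin -!prE// le_measure// inE.
Qed.

Lemma pr_le1 A : measurable A -> pr A <= 1.
Proof. by move=> mA; rewrite -lee_fin -prE// probability_le1. Qed.

Lemma prU A B : measurable A -> measurable B -> A `&` B = set0 ->
  pr (A `|` B) = pr A + pr B.
Proof.
move=> mA mB AB0; apply: EFin_inj.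
by rewrite EFinD -!prE ?measureU//; exact: measurableU.
Qed.

Lemma prD A B : measurable A -> measurable B -> B `<=` A ->
  pr (A `\` B) = pr A - pr B.
Proof.
move=> mA mB BA; rewrite -{2}(setDUK BA) prU ?setDIK//.
  by rewrite [X in X - _]addrC addrK.
exact: measurableD.
Qed.

Lemma prC A : measurable A -> pr (~` A) = 1 - pr A.
Proof. by move=> mA; rewrite -setTD prD// prT. Qed.

Hypothesis atomlessP : atomless P.

(** When [B] is split in two parts of positive probability, one of them has at most half the
    probability of [B]; iterating makes the probability arbitrarily small. *)
Lemma atomless_small A (e : R) : measurable A -> 0 < pr A -> 0 < e ->
  exists B, [/\ measurable B, B `<=` A, 0 < pr B & pr B < e].
Proof.
move=> mA A0 e0.
have halving n : exists B, [/\ measurable B, B `<=` A, 0 < pr B &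
    pr B <= 2^-1 ^+ n].
  elim: n => [|n [B [mB BA B0 Bn]]]; first by exists A; split=> //; exact: pr_le1.
  have [|C [mC CB]] := atomlessP mB; first by rewrite prE.
  rewrite !prE// !lte_fin => /andP[C0 ltCB].
  rewrite exprS; have [Ch|Ch] := leP (pr C) (2^-1 * pr B).
    exists C; split=> //; first exact: subset_trans BA.
    by apply: le_trans Ch _; rewrite ler_wpM2l.
  exists (B `\` C); rewrite prD//; split.
  - exact: measurableD.
  - by move=> x [/BA].
  - by rewrite subr_gt0.
  - by apply: (@le_trans _ _ (2^-1 * pr B)); [lra | rewrite ler_wpM2l].
have : (2^-1 : R) ^+ n @[n --> \oo] --> (0 : R).
  by apply: cvg_expr; rewrite ger0_norm// invf_lt1// ltr1n.
move=> /cvgrPdist_lt/(_ e e0)[] N _ /(_ N (leqnn _)) /=; rewrite sub0r normrN => hN.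
have [B [mB BA B0 BN]] := halving N.
by exists B; split=> //; apply: (le_lt_trans BN); apply: le_lt_trans hN; rewrite ler_norm.
Qed.

(* Sierpinski's theorem. At each step the greedy choice adds a subset of at
   least half the largest admissible probability; if the union were too small,
   a fixed set of positive probability would stay admissible for ever. *)
Lemma sierpinski A (t : R) : measurable A -> 0 <= t <= pr A ->
  exists B, [/\ measurable B, B `<=` A & pr B = t].
Proof.
move=> mA /andP[t0 tA].
pose good B := [/\ measurable B, B `<=` A & pr B <= t].
have greedy B : exists B', good B -> [/\ good B', B `<=` B' &
    forall C, measurable C -> C `<=` A `\` B ->
      pr C <= t - pr B -> pr C <= 2 * (pr B' - pr B)].
  have [gB|nB] := pselect (good B); last by exists B.
  case: (gB) => mB BA Bt.
  pose adm := [set C | [/\ measurable C, C `<=` A `\` B & pr C <= t - pr B]].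
  have adm0 : adm set0 by split=> //; rewrite pr_set0 subr_ge0.
  have ubadm : has_sup (pr @` adm).
    split; first by exists (pr set0), set0.
    by exists 1 => _ [C [mC _ _] <-]; exact: pr_le1.
  have s0 : 0 <= sup (pr @` adm).
    by rewrite -pr_set0; apply: ub_le_sup; [case: ubadm | exists set0].
  have [C [mC CAB Ct] Cs] : exists2 C, adm C & sup (pr @` adm) <= 2 * pr C.
    move: s0; rewrite le_eqVlt => /predU1P[<-|s0].
      by exists set0 => //; rewrite pr_set0 mulr0.
    have [|_ [C aC <-] h] := @sup_adherent _ _ (2^-1 * sup (pr @` adm)) _ ubadm.
      by rewrite mulr_gt0.
    by exists C => //; lra.
  have BC0 : B `&` C = set0.
    by apply/seteqP; split=> // x [Bx /CAB[]].
  exists (B `|` C) => _; rewrite /good prU//; split.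
  - split; [exact: measurableU| |lra].
    by move=> x [/BA//|/CAB[]].
  - exact: subsetUl.
  - move=> D mD DAB Dt; rewrite addrAC subrr add0r; apply: le_trans Cs.
    by apply: ub_le_sup; [case: ubadm | exists D].
have [f Hf] := choice greedy.
pose F n := iter n f set0.
have good0 : good set0 by split=> //; rewrite pr_set0.
have gF n : good (F n) by elim: n => //= n /Hf[].
have mF n : measurable (F n) by case: (gF n).
have ndF : nondecreasing_seq F.
  by apply/nondecreasing_seqP => n; apply/subsetPset; case: (Hf _ (gF n)).
pose U := \bigcup_n F n.
have mU : measurable U by exact: bigcup_measurable.
have UA : U `<=` A by move=> x [n _ /=]; case: (gF n) => _ + _; exact.
have Ut : pr U <= t.
  rewrite -lee_fin -prE//.
  have h := nondecreasing_cvg_mu (mu := P) mF mU ndF.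
  rewrite -(cvg_lim _ h)//; apply: lime_le; first by apply/cvg_ex; exists (P U).
  by apply: nearW => n /=; rewrite prE// lee_fin; case: (gF n).
have [->|ne] := eqVneq t (pr U); first by exists U.
have ltU : pr U < t by rewrite lt_neqAle eq_sym ne.
have [| | |C [mC CAU C0 CtU]] := @atomless_small (A `\` U) (t - pr U).
- exact: measurableD.
- by rewrite prD// subr_gt0; exact: lt_le_trans tA.
- by rewrite subr_gt0.
have step n : pr C <= 2 * (pr (F n.+1) - pr (F n)).
  have [_ _] := Hf _ (gF n); apply=> //.
    by move=> x /CAU[Ax nUx]; split=> // Fx; apply: nUx; exists n.
  have : pr (F n) <= pr U by apply: le_pr => // x Fx; exists n.
  lra.
have tot n : n%:R * pr C <= 2 * pr (F n).
  elim: n => [|n ih]; first by rewrite mul0r pr_set0 mulr0.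
  by have := step n; rewrite -natr1; lra.
pose n := Num.bound (2 / pr C).
have : 2 < n%:R * pr C.
  rewrite -ltr_pdivrMr//; apply: le_lt_trans (archi_boundP _); first by [].
  by rewrite divr_ge0// ltW.
by have := tot n; have := pr_le1 (mF n); lra.
Qed.

End real_probability.

(** * The value at risk as a generalized inverse of the distribution function *)

Section value_at_risk.
Context {d : measure_display} {T : measurableType d} {R : realType}.
Variable P : probability T R.
Implicit Type X : {RV P >-> R}.

Lemma measurable_le (X : {mfun T >-> R}) y : measurable [set w | X w <= y].
Proof.
have -> : [set w | X w <= y] = X @^-1` `]-oo, y].
  by apply/seteqP; split=> w /=; rewrite in_itv.
exact: measurable_funPTI.
Qed.

Lemma cdfE X y : cdf X y = (pr P [set w | X w <= y])%:E.
Proof.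
by rewrite -prE; last exact: measurable_le.
Qed.

(** The limits 0 and 1 of the distribution function make the set defining [VaR] nonempty and bounded
    below, and right continuity makes its infimum attained. *)
Lemma VaR_le X (s y : R) : 0 < s < 1 ->
  (VaR P s X <= y) = (s <= pr P [set w | X w <= y]).
Proof.
move=> /andP[s0 s1].
rewrite /VaR; set D := [set x : R | _].
have DE x : D x = (s%:E <= cdf X x)%E.
  by rewrite cdfE -prE//; exact: measurable_le.
have [x Dx] : D !=set0.
  have /(cvg_cdfy1 X) : nbhs 1%E [set u | (s%:E < u)%E].
    by apply: open_ereal_gt'; rewrite lte_fin.
  case=> M [_ /(_ (M + 1))]; rewrite ltrDl ltr01 => /(_ isT) h.
  by exists (M + 1); rewrite DE ltW.
have [N hN] : exists N, lbound D N.
  have /(cvg_cdfNy0 X) : nbhs 0%E [set u | (u < s%:E)%E].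
    by apply: open_ereal_lt'; rewrite lte_fin.
  case=> M [_ /(_ (M - 1))]; rewrite gtrDl ltrN10 => /(_ isT) h.
  exists (M - 1) => y'; rewrite DE => hy; rewrite leNgt; apply/negP => ly.
  have := le_lt_trans (cdf_nondecreasing X (ltW ly)) h.
  by rewrite ltNge hy.
have hD : has_inf D by split; [exists x|exists N].
rewrite -[RHS]lee_fin -cdfE.
apply/idP/idP => [vy|sy]; last first.
  by apply: ge_inf; [exists N | rewrite DE].
apply: le_trans (cdf_nondecreasing X vy).
rewrite leNgt; apply/negP => lts.
have /(cdf_right_continuous (X := X)) :
    nbhs (cdf X (inf D)) [set u | (u < s%:E)%E] by exact: open_ereal_lt'.
move=> [e /= e0 he].
have [z Dz zlt] := inf_adherent e0 hD.
have := ge_inf (proj2 hD) Dz.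
rewrite le_eqVlt => /predU1P[iz|iz].
  by move: lts; rewrite iz ltNge; move: Dz; rewrite DE => ->.
have := he z; rewrite /ball_/= => /(_ _ iz).
rewrite ltr0_norm ?subr_lt0// opprB ltrBlDl => /(_ zlt).
by rewrite ltNge; move: Dz; rewrite DE => ->.
Qed.

End value_at_risk.

(** * Expected shortfall through the mean excess over the value at risk *)

Section excess.
Context {d : measure_display} {T : measurableType d} {R : realType}.
Variables (P : probability T R).

Lemma integrable_excess (X : T -> R) (t : R) :
  P.-integrable [set: T] (EFin \o X) ->
  P.-integrable [set: T] (EFin \o (fun w => Num.max (X w - t) 0)).
Proof.
move=> iX.
have iXt : P.-integrable [set: T] (EFin \o (fun w => X w - t)).
  under [_ \o _]eq_fun do rewrite /= EFinB.
  apply: integrableB => //; exact: finite_measure_integrable_cst.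
apply: (le_integrable _ _ _ iXt) => //.
  apply/measurable_EFinP; apply: measurable_maxr => //.
  exact/measurable_EFinP/(measurable_int _ iXt).
move=> w _ /=; rewrite lee_fin.
by rewrite ger0_norm ?le_max ?lexx ?orbT// ge_max normr_ge0 ler_norm.
Qed.

End excess.
Section expected_shortfall.
Context {d : measure_display} {T : measurableType d} {R : realType}.
Variables (P : probability T R) (p : R).
Hypothesis p01 : 0 < p < 1.
Variable X : {RV P >-> R}.

Let p0 : 0 < p. Proof. by case/andP: p01. Qed.
Let p1 : p < 1. Proof. by case/andP: p01. Qed.
Let v := VaR P p X.
(** The value 0 outside []p, 1[] makes [Q] a nonnegative random variable under the uniform law
    [U]. *)
Let Q (s : R) : R := if p < s < 1 then VaR P s X - v else 0.
Let U : probability (measurableTypeR R) R := uniform_prob p1.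

Lemma le_pr_VaR : p <= pr P [set w | X w <= v].
Proof. by rewrite -VaR_le. Qed.

Lemma VaR_gt (r s : R) : p < s < 1 ->
  (r < VaR P s X) = (pr P [set w | X w <= r] < s).
Proof.
by case/andP=> ps s1; rewrite !ltNge VaR_le// s1 andbT (lt_trans p0).
Qed.

(** Superlevel sets of [Q] are intervals, which yields both its measurability and its tail
    function. *)
Let Q_gt r : 0 <= r ->
  [set s | r < Q s] = `]pr P [set w | X w <= v + r], 1[%classic.
Proof.
move=> r0; apply/seteqP; split=> s; rewrite /= /Q in_itv/=.
  case: ifPn => [ps|_]; last by rewrite ltNge r0.
  by rewrite ltrBrDl VaR_gt//; case/andP: ps => _ -> ->.
case/andP => Fs s1.
have ps : p < s.
  apply: le_lt_trans le_pr_VaR _; apply: le_lt_trans Fs.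
  by apply: le_pr; [exact: measurable_le|exact: measurable_le|move=> w /=; lra].
by rewrite ps s1 ltrBrDl VaR_gt ?ps// Fs.
Qed.

Let Q_ge0 s : 0 <= Q s.
Proof.
rewrite /Q; case: ifP => // /andP[ps s1].
rewrite subr_ge0 VaR_le//; apply: le_trans (ltW ps) _.
by rewrite -VaR_le ?s1 ?(lt_trans p0 ps).
Qed.

Let mQ : measurable_fun [set: measurableTypeR R] (Q : measurableTypeR R -> R).
Proof.
apply: (measurability (@RGenOInfty.G R)) => [|/= _ [_] [r] -> <-].
  exact: RGenOInfty.measurableE.
have E : [set s | r < Q s] = Q @^-1` `]r, +oo[.
  by apply/seteqP; split=> s /=; rewrite in_itv andbT.
rewrite setTI -E; have [r0|r0] := leP 0 r; first by rewrite Q_gt.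
rewrite (_ : [set s | _] = setT)//.
by apply/seteqP; split=> s //= _; exact: lt_le_trans (Q_ge0 s).
Qed.

Let QU : {RV U >-> R} := @mfun_Sub _ _ (measurableTypeR R) R Q (mem_set mQ).

Let Z : T -> R := fun w => Num.max (X w - v) 0.

Let mZ : measurable_fun [set: T] Z.
Proof. by apply: measurable_maxr => //; apply: measurable_funB. Qed.

Let ZP : {RV P >-> R} := mfun_Sub (mem_set mZ).

(** By [Q_gt], the event is the interval []F, 1[], on which the uniform density is [1 / (1 - p)]. *)
Let ccdfQ r : 0 <= r ->
  ccdf QU r = ((1 - p)^-1 * pr P [set w | v + r < X w])%:E.
Proof.
move=> r0; rewrite /ccdf /distribution /pushforward.
set F := pr P [set w | X w <= v + r].
have pF : p <= F.
  apply: le_trans le_pr_VaR _.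
  by apply: le_pr; [exact: measurable_le|exact: measurable_le|move=> w /=; lra].
have F1 : F <= 1 by apply: pr_le1; exact: measurable_le.
have -> : pr P [set w | v + r < X w] = 1 - F.
  rewrite -prC; last exact: measurable_le.
  by congr (pr P _); apply/seteqP; split=> w /=; rewrite ltNge => /negP.
rewrite (_ : _ @^-1` _ = `]F, 1[%classic); last first.
  by rewrite -Q_gt//; apply/seteqP; split=> s /=; rewrite in_itv/= andbT.
rewrite [LHS](_ : _ = \int[lebesgue_measure]_(s in `]F, 1%R[)
  (uniform_pdf p 1 s)%:E)%E//.
rewrite (eq_integral (cst (1 - p)^-1%:E)); last first.
  move=> s; rewrite inE/= in_itv/= => /andP[Fs s1].
  by rewrite /uniform_pdf (ltW s1) (le_trans pF (ltW Fs)).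
rewrite integral_cst//= lebesgue_measure_itv/= lte_fin.
(* If [F = 1], the interval is empty and both sides vanish. *)
move: F1; rewrite le_eqVlt => /predU1P[->|->]; last by rewrite EFinM.
by rewrite ltxx subrr mulr0 mule0.
Qed.

Let ccdfZ r : 0 <= r ->
  ccdf ZP r = (pr P [set w | v + r < X w])%:E.
Proof.
move=> r0; rewrite /ccdf /distribution /pushforward.
rewrite (_ : _ @^-1` _ = [set w | v + r < X w]).
  rewrite -prE//; have -> : [set w | v + r < X w] = ~` [set w | X w <= v + r].
    by apply/seteqP; split=> w /=; rewrite ltNge => /negP.
  by apply: measurableC; exact: measurable_le.
apply/seteqP; split=> w /=; rewrite in_itv/= andbT /Z lt_max; lra.
Qed.

(** Layer-cake formula: both sides are integrals of tail functions, whose ratio [1 / (1 - p)]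
    cancels against the uniform density. *)
Let integralQ : (\int[lebesgue_measure]_(s in `]p, 1%R[) (Q s)%:E = 'E_P[Z])%E.
Proof.
have p1_gt0 : 0 < 1 - p by rewrite subr_gt0.
have p1_neq0 : 1 - p != 0 by rewrite gt_eqF.
(* The uniform law lives on the closed interval; [Q] vanishes at its endpoints. *)
transitivity (\int[lebesgue_measure]_(s in `[p, 1%R]) (Q s)%:E)%E.
  rewrite integral_mkcond [RHS]integral_mkcond; apply: eq_integral => s _.
  rewrite !patchE !mem_setE !in_itv/= /Q.
  case: (boolP (p < s < 1)) => [/andP[ps s1]|_]; last by rewrite if_same.
  by rewrite (ltW ps) (ltW s1).
transitivity ((1 - p)%:E * 'E_U[QU])%E.
  rewrite expectation_def [in RHS](@integral_uniform _ _ _ _ (EFin \o Q)).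
  - by rewrite muleA -EFinM mulfV// mul1e.
  - exact/measurable_EFinP.
  - by move=> s; rewrite lee_fin.
rewrite ge0_expectation_ccdf// (_ : 'E_P[Z] = 'E_P[ZP])%E//.
rewrite ge0_expectation_ccdf; last first.
  by move=> w; rewrite /= /Z le_max lexx orbT.
rewrite -ge0_integralZl//.
- apply: eq_integral => r /[!inE] ry.
  have r0 : 0 <= r by move: ry; rewrite /= in_itv/= andbT.
  by rewrite ccdfQ// ccdfZ// -EFinM mulrA mulfV// mul1r.
- apply: measurable_funTS; exact: (@ccdf_measurable _ _ _ U QU).
- by rewrite lee_fin ltW.
Qed.

Lemma ES_VaRE : P.-integrable [set: T] (EFin \o X) ->
  (1 - p) * ES P p X =
  (1 - p) * VaR P p X + mean P (fun w => Num.max (X w - VaR P p X) 0).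
Proof.
move=> iX.
have p1_gt0 : 0 < 1 - p by rewrite subr_gt0.
have p1_neq0 : 1 - p != 0 by rewrite gt_eqF.
have iZ : P.-integrable [set: T] (EFin \o Z) by exact: integrable_excess.
have iQ : lebesgue_measure.-integrable `]p, 1%R[ (EFin \o Q).
  apply/integrableP; split; first exact/measurable_EFinP/measurable_funTS.
  under eq_integral do rewrite /= ger0_norm//.
  by rewrite integralQ unlock ltey_eq integrable_fin_num.
rewrite /ES mulrA mulfV// mul1r.
have -> : \int[lebesgue_measure]_(s in `]p, 1%R[) VaR P s X =
    \int[lebesgue_measure]_(s in `]p, 1%R[) (v + Q s).
  apply: eq_Rintegral => s; rewrite inE/= in_itv/= /Q => ->.
  by rewrite addrC subrK.
rewrite RintegralD//; last first.
  apply: (@measurable_bounded_integrable _ _ _ _ (cst v)) => //.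
    by rewrite /= lebesgue_measure_itv/= lte_fin p1 -EFinB ltry.
  exact: bounded_cst.
rewrite Rintegral_cst//= lebesgue_measure_itv/= lte_fin p1 /= mulrC; congr (_ + _).
by rewrite /Rintegral integralQ.
Qed.

End expected_shortfall.

(** * Linearity and monotonicity of the real-valued mean *)

Section mean_lemmas.
Context {d : measure_display} {T : measurableType d} {R : realType}.
Variables (P : probability T R).
Implicit Types (f g : T -> R) (A : set T).

Local Notation L1 f := (P.-integrable [set: T] (EFin \o f)).

Lemma meanE f : mean P f = \int[P]_w f w.
Proof. by rewrite /mean unlock. Qed.

Lemma integrable_add f g : L1 f -> L1 g -> L1 (fun w => f w + g w).
Proof.
move=> fi gi; under [_ \o _]eq_fun do rewrite /= EFinD.
exact: integrableD.
Qed.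

Lemma integrable_scale f c : L1 f -> L1 (fun w => c * f w).
Proof.
move=> fi; under [_ \o _]eq_fun do rewrite /= EFinM.
exact: integrableZl.
Qed.

Lemma integrable_const c : L1 (fun=> c).
Proof. exact: finite_measure_integrable_cst. Qed.

Lemma integrable_mul_indic f A : measurable A -> L1 f ->
  L1 (fun w => f w * \1_A w).
Proof.
move=> mA fi; apply: (le_integrable _ _ _ fi) => //.
  apply/measurable_EFinP; apply: measurable_funM => //.
  exact/measurable_EFinP/(measurable_int _ fi).
move=> w _ /=; rewrite lee_fin normrM ler_piMr//.
by rewrite indicE; case: (_ \in _); rewrite ?normr1 ?normr0.
Qed.

Lemma integrable_indic1 A : measurable A -> L1 (\1_A).
Proof.
move=> mA; have := integrable_mul_indic mA (integrable_const 1).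
by under eq_fun do rewrite mul1r.
Qed.

Lemma meanD f g : L1 f -> L1 g ->
  mean P (fun w => f w + g w) = mean P f + mean P g.
Proof. by move=> fi gi; rewrite !meanE RintegralD. Qed.

Lemma meanZ f c : L1 f -> mean P (fun w => c * f w) = c * mean P f.
Proof. by move=> fi; rewrite !meanE RintegralZl. Qed.

Lemma mean_cst c : mean P (fun=> c) = c.
Proof. by rewrite meanE Rintegral_cst//= probability_setT mulr1. Qed.

Lemma mean_indic A : measurable A -> mean P (\1_A) = pr P A.
Proof. by move=> mA; rewrite /mean expectation_indic. Qed.

Lemma mean_le f g : L1 f -> L1 g -> (forall w, f w <= g w) ->
  mean P f <= mean P g.
Proof. by move=> fi gi fg; rewrite !meanE le_Rintegral. Qed.

Lemma ae_eq_mean f g : L1 f -> L1 g -> {ae P, forall w, f w = g w} ->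
  mean P f = mean P g.
Proof.
move=> fi gi fg; rewrite !meanE /Rintegral; congr fine.
apply: ae_eq_integral => //; [exact: measurable_int fi|exact: measurable_int gi|].
by apply: filterS fg => w /= ->.
Qed.

Lemma mean_mul_indicB f A (t : R) : measurable A -> L1 f ->
  mean P (fun w => (f w - t) * \1_A w) = mean P (fun w => f w * \1_A w) - t * pr P A.
Proof.
move=> mA fi.
have i1 := integrable_indic1 mA.
rewrite -mean_indic// -mulNr -meanZ// -meanD//; last 2 first.
- exact: integrable_mul_indic.
- exact: integrable_scale.
by congr (mean P); apply/funext => w; rewrite mulrBl mulNr.
Qed.

End mean_lemmas.

(** * Expected shortfall as a maximum of means over events of probability [1 - p] *)

Section expected_shortfall_properties.
Context {d : measure_display} {T : measurableType d} {R : realType}.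
Variables (P : probability T R) (p : R).
Hypotheses (atomlessP : atomless P) (p01 : 0 < p < 1).
Implicit Types (X Y Z : {RV P >-> R}) (A B : set T).

Local Notation L1 f := (P.-integrable [set: T] (EFin \o f)).

Let p1 : p < 1. Proof. by case/andP: p01. Qed.
Let p1_gt0 : 0 < 1 - p. Proof. by rewrite subr_gt0. Qed.

(** By [VaR_le], each event [F n] has probability below [p], and these events increase to the given
    one. *)
Lemma pr_lt_VaR X : pr P [set w | X w < VaR P p X] <= p.
Proof.
pose F n := [set w | X w <= VaR P p X - n.+1%:R^-1].
have mF n : measurable (F n) by exact: measurable_le.
have -> : [set w | X w < VaR P p X] = \bigcup_n F n.
  apply/seteqP; split=> w /=.
    move=> /ltr_add_invr[k hk]; exists k => //=.
    by rewrite /F/= lerBrDr ltW.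
  move=> [n _]; rewrite /F/= => h; apply: le_lt_trans h _.
  by rewrite ltrBlDr ltrDl invr_gt0.
rewrite -lee_fin -prE; last exact: bigcup_measurable.
have cF : P (F n) @[n --> \oo] --> P (\bigcup_n F n).
  apply: nondecreasing_cvg_mu => //; first exact: bigcup_measurable.
  apply/nondecreasing_seqP => n; apply/subsetPset => w; rewrite /F/= => h.
  apply: le_trans h _; rewrite lerD2l lerN2 lef_pV2 ?posrE// ler_nat//.
rewrite -(cvg_lim _ cF)//; apply: lime_le; first by apply/cvg_ex; eexists; exact: cF.
apply: nearW => n /=; rewrite prE// lee_fin ltW// ltNge -VaR_le// -ltNge.
by rewrite ltrBlDr ltrDl invr_gt0.
Qed.

(** The event [G] has probability at most [1 - p], and adding the level set of [v] brings it to at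
    least [1 - p]; Sierpinski's theorem provides the piece [C] of the level set that completes
    [G]. *)
Lemma exists_tail X : exists A, [/\ measurable A, pr P A = 1 - p,
  forall w, A w -> VaR P p X <= X w & forall w, ~ A w -> X w <= VaR P p X].
Proof.
set v := VaR P p X.
pose L := [set w | X w <= v]; pose G := [set w | v < X w].
have mL : measurable L by exact: measurable_le.
have GE : G = ~` L by apply/seteqP; split=> w; rewrite /G /L/= ltNge => /negP.
have mG : measurable G by rewrite GE; exact: measurableC.
have mlt : measurable [set w | X w < v].
  rewrite (_ : [set w | _] = X @^-1` `]-oo, v[); first exact: measurable_funPTI.
  by apply/seteqP; split=> w /=; rewrite in_itv.
have mE : measurable (L `\` [set w | X w < v]) by exact: measurableD.
have [|C [mC CE Cp]] := sierpinski atomlessP (t := 1 - p - pr P G) mE.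
  rewrite prD//; last by move=> w /ltW.
  rewrite GE prC//.
  have := pr_lt_VaR X; have := le_pr_VaR p01 X; rewrite -/v -/L.
  by move=> h1 h2; apply/andP; split; lra.
exists (G `|` C); split.
- exact: measurableU.
- rewrite prU// ?Cp; first by lra.
  by apply/seteqP; split=> // w [+ /CE[]]; rewrite GE.
- by move=> w [/ltW//|/CE[_ /= /negP]]; rewrite -leNgt.
- by move=> w; rewrite GE => /not_orP[/contrapT].
Qed.

(** With [v] the value at risk, [(X - v) * \1_A] is pointwise at most the excess of [X] over [v],
    whose mean appears in [ES_VaRE]. *)
Lemma mean_mul_indic_le_ES X A : L1 X -> measurable A -> pr P A = 1 - p ->
  mean P (fun w => X w * \1_A w) <= (1 - p) * ES P p X.
Proof.
move=> iX mA pA; rewrite ES_VaRE// -lerBlDl -[X in _ - X]mulrC -pA.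
rewrite -mean_mul_indicB//; apply: mean_le.
- apply: integrable_mul_indic => //.
  by apply: integrable_add => //; exact: integrable_const.
- exact: integrable_excess.
- move=> w; rewrite indicE le_max; case: (_ \in _); rewrite ?mulr1 ?mulr0 lexx//.
  by rewrite orbT.
Qed.

Lemma mean_tail_VaR X A : L1 X -> measurable A -> pr P A = 1 - p ->
  (forall w, A w -> VaR P p X <= X w) -> (forall w, ~ A w -> X w <= VaR P p X) ->
  mean P (fun w => X w * \1_A w) = (1 - p) * ES P p X.
Proof.
move=> iX mA pA AX XA; rewrite ES_VaRE// -pA mulrC.
rewrite [RHS](_ : _ = mean P (fun w => (X w - VaR P p X) * \1_A w) +
  VaR P p X * pr P A); first by rewrite mean_mul_indicB// subrK.
rewrite addrC; congr (mean P _ + _); apply/funext => w.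
rewrite indicE; have [/set_mem Aw|/negP Aw] := boolP (w \in A).
  by rewrite mulr1 max_l// subr_ge0 AX.
by rewrite mulr0 max_r// subr_le0 XA// => /mem_set.
Qed.

(* Rockafellar-Uryasev: the bound is attained at [t = VaR_p X]. *)
Lemma ES_le_excess X t : L1 X ->
  (1 - p) * ES P p X <= (1 - p) * t + mean P (fun w => Num.max (X w - t) 0).
Proof.
move=> iX; have [A [mA pA AX XA]] := exists_tail X.
rewrite -(mean_tail_VaR iX mA pA AX XA) -lerBlDl -[X in _ - X]mulrC -pA.
rewrite -mean_mul_indicB//; apply: mean_le.
- apply: integrable_mul_indic => //.
  by apply: integrable_add => //; exact: integrable_const.
- exact: integrable_excess.
- move=> w; rewrite indicE le_max; case: (_ \in _); rewrite ?mulr1 ?mulr0 lexx//.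
  by rewrite orbT.
Qed.

(** A tail event of the sum is a competitor in the maxima defining the two other expected
    shortfalls. *)
Lemma ES_subadd X Y Z : L1 X -> L1 Y -> L1 Z ->
  (forall w, Z w = X w + Y w) -> ES P p Z <= ES P p X + ES P p Y.
Proof.
move=> iX iY iZ ZE; have [A [mA pA AZ ZA]] := exists_tail Z.
rewrite -(ler_pM2l p1_gt0) mulrDr -(mean_tail_VaR iZ mA pA AZ ZA).
under eq_fun do rewrite ZE mulrDl.
rewrite meanD; [|exact: integrable_mul_indic..].
by apply: lerD; exact: mean_mul_indic_le_ES.
Qed.

Lemma ES_mono X Y : L1 X -> L1 Y -> (forall w, X w <= Y w) ->
  ES P p X <= ES P p Y.
Proof.
move=> iX iY XY; have [A [mA pA AX XA]] := exists_tail X.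
rewrite -(ler_pM2l p1_gt0) -(mean_tail_VaR iX mA pA AX XA).
apply: le_trans (mean_mul_indic_le_ES iY mA pA).
apply: mean_le => [||w]; [exact: integrable_mul_indic..|].
by rewrite ler_wpM2r// indicE.
Qed.

Lemma ES_shift X Y c : L1 X -> L1 Y -> (forall w, Y w = X w + c) ->
  ES P p Y = ES P p X + c.
Proof.
move=> iX iY YE.
have shift A : measurable A -> pr P A = 1 - p ->
    mean P (fun w => Y w * \1_A w) = mean P (fun w => X w * \1_A w) + (1 - p) * c.
  move=> mA pA; rewrite -pA -[in RHS]mulrC -[c]opprK mulNr -mean_mul_indicB//.
  by congr (mean P _); apply/funext => w; rewrite opprK YE.
apply: (mulfI (lt0r_neq0 p1_gt0)); apply/eqP; rewrite eq_le mulrDr; apply/andP; split.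
  have [A [mA pA AX XA]] := exists_tail Y.
  rewrite -(mean_tail_VaR iY mA pA AX XA) shift// lerD2r.
  exact: mean_mul_indic_le_ES.
have [A [mA pA AX XA]] := exists_tail X.
rewrite -(mean_tail_VaR iX mA pA AX XA) -shift//.
exact: mean_mul_indic_le_ES.
Qed.

(** Off a tail event, [X] is at most its value at risk, which is itself at most the expected
    shortfall. *)
Lemma ES_ge_mean X : L1 X -> mean P X <= ES P p X.
Proof.
move=> iX; have [A [mA pA AX XA]] := exists_tail X.
have pA' : pr P (~` A) = p by rewrite prC// pA; lra.
have h1 := mean_tail_VaR iX mA pA AX XA.
have mA' : measurable (~` A) by exact: measurableC.
have mE : mean P X = mean P (fun w => X w * \1_A w) +
    mean P (fun w => X w * \1_(~` A) w).
  rewrite -meanD; [|exact: integrable_mul_indic..].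
  congr (mean P _); apply/funext => w; rewrite -mulrDr !indicE in_setC.
  by case: (_ \in _); rewrite ?addr0 ?add0r mulr1.
have ub : mean P (fun w => X w * \1_(~` A) w) <= VaR P p X * p.
  rewrite -subr_le0; have := mean_mul_indicB (VaR P p X) mA' iX.
  rewrite pA' => <-; rewrite -(mean_cst P 0).
  apply: mean_le => [||w].
  - apply: integrable_mul_indic => //.
    by apply: integrable_add => //; exact: integrable_const.
  - exact: integrable_const.
  - rewrite indicE; have [/set_mem Aw|_] := boolP (w \in ~` A).
      by rewrite mulr1 subr_le0; exact: XA.
    by rewrite mulr0.
have lb : (1 - p) * VaR P p X <= (1 - p) * ES P p X.
  rewrite ES_VaRE// lerDl -[leLHS](mean_cst P).
  apply: mean_le => [||w]; [exact: integrable_const|exact: integrable_excess|].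
  by rewrite le_max lexx orbT.
move: lb; rewrite ler_pM2l// => lb.
have p0 : 0 <= p by case/andP: p01 => /ltW.
have := ler_wpM2r p0 lb.
by rewrite mE h1; lra.
Qed.

(** It suffices to find a threshold [t] that separates, almost surely, the values of [X] off [A]
    from those on [A]: the excess over [t] is then [(X - t) * \1_A] almost surely, and
    [ES_le_excess] gives the missing inequality. *)
Lemma tail_event_mean X A : L1 X -> p_tail_event P p X A ->
  mean P (fun w => X w * \1_A w) = (1 - p) * ES P p X.
Proof.
move=> iX [[mA /andP[PA0 PA1] tA] PAp].
have pA : pr P A = 1 - p by rewrite /pr PAp.
have pA' : pr P (~` A) = p by rewrite prC// pA; lra.
apply/eqP; rewrite eq_le mean_mul_indic_le_ES//=.
(* The infimum of [S] is the essential supremum of [X] off [A]. *)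
pose S := [set x | {ae P, forall w, ~ A w -> X w <= x}].
have S0 : S !=set0.
  (* Almost every [w] in [A] has [X w] in [S]; were [S] empty, [A] would be negligible. *)
  apply: contrapT => nS.
  have : {ae P, forall w, ~ A w}.
    by apply: filterS tA => w h Aw; apply: nS; exists (X w); exact: h.
  move=> nA; have /(negligibleP _ mA) : P.-negligible A.
    by apply: negligibleS nA => w Aw /(_ Aw).
  by move=> A0; move: PA0; rewrite A0 ltxx.
(* If [X <= x] almost surely off [A], then this inequality has probability at least that of the
   complement of [A], which is [p]. *)
have lS : lbound S (VaR P p X).
  move=> x Sx; rewrite VaR_le//.
  set L := [set w | X w <= x].
  have mL : measurable L by exact: measurable_le.
  have mN : measurable (~` A `\` L) by apply: measurableD => //; exact: measurableC.
  have N0 : pr P (~` A `\` L) = 0.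
    rewrite /pr (_ : P _ = 0%E)//; apply/(negligibleP _ mN).
    by apply: negligibleS Sx => w [Aw Lw] /(_ Aw).
  rewrite -pA' -[leRHS]addr0 -N0 -prU//; last first.
    by apply/seteqP; split=> // w [+ []].
  apply: le_pr => [||w Aw]; [exact: measurableC|exact: measurableU|].
  by have [Lw|Lw] := pselect (L w); [left|right].
pose t := inf S.
have iS : has_inf S by split; last by exists (VaR P p X).
have ubt : {ae P, forall w, ~ A w -> X w <= t}.
  have : {ae P, forall w n, ~ A w -> X w <= t + n.+1%:R^-1}.
    apply: ae_foralln => n.
    have [|x Sx xt] := inf_adherent _ iS (eps := n.+1%:R^-1); first by [].
    by apply: filterS Sx => w h /h /le_trans; apply; exact: ltW.
  apply: filterS => w h nA; apply/ler_addgt0Pr => e e0.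
  have [k] := ltr_add_invr e0; rewrite add0r => /ltW ke.
  by apply: le_trans (h k nA) _; rewrite lerD2l.
have lbt : {ae P, forall w, A w -> t <= X w}.
  by apply: filterS tA => w h /h Sw; apply: ge_inf => //; exists (VaR P p X).
apply: le_trans (ES_le_excess t iX) _.
rewrite -lerBrDl -pA [X in _ - X]mulrC -mean_mul_indicB//.
rewrite (@ae_eq_mean _ _ _ _ _ (fun w => (X w - t) * \1_A w))//.
- exact: integrable_excess.
- apply: integrable_mul_indic => //.
  by apply: integrable_add => //; exact: integrable_const.
- apply: filterS2 ubt lbt => w ub lb; rewrite indicE.
  have [/set_mem Aw|/negP Aw] := boolP (w \in A).
    by rewrite mulr1 max_l// subr_ge0 lb.
  by rewrite mulr0 max_r// subr_le0 ub// => /mem_set.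
Qed.

End expected_shortfall_properties.

(** * Sufficiency of the mean-ES form, and SSD-consistency *)

Section mean_ES_risk.
Context {d : measure_display} {T : measurableType d} {R : realType}.
Context {P : probability T R} {q : R} {q1 : (1 <= q%:E)%E}.
Variable p : R.
Hypotheses (atomlessP : atomless P) (p01 : 0 < p < 1).
Local Notation Lq := (LfunType P q1).
Implicit Types (rho : Lq -> R) (X Y : Lq).

Local Notation L1 f := (P.-integrable [set: T] (EFin \o f)).

Lemma Lq_integrable X : L1 X.
Proof.
apply/Lfun1_integrable; apply: (Lfun_subset _ q1) (LfunP X) => //.
by rewrite fin_num_measure.
Qed.

Lemma convex_excess (t : R) :
  convex_function [set: R^o] (fun x : R => Num.max (x - t) 0).
Proof.
move=> a x y _ _.
rewrite [X in Num.max (X - _)]convRE [leRHS]convRE /unstable.onem.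
have : 0 <= a%:num <= 1 by apply/andP.
move: (a%:num) => /= s /andP[s0 s1]; rewrite -subr_ge0 in s1.
rewrite ge_max; apply/andP; split.
  rewrite [leLHS](_ : _ = s * (x - t) + (1 - s) * (y - t)); last by ring.
  by rewrite lerD// ler_wpM2l// le_max lexx.
by rewrite addr_ge0// mulr_ge0// le_max lexx orbT.
Qed.

(** If [e - m] grows, [g] is increasing. If it shrinks, it does so by at most [m2 - m1] because
    [e1 <= e2], so the 1-Lipschitz [g] loses no more than the second term gains. *)
Lemma mean_ES_homo (g : R -> R) (e1 m1 e2 m2 : R) :
  {in `[0, +oo[ &, {homo g : x y / x <= y}} ->
  {in `[0, +oo[ &, forall x y, `|g x - g y| <= `|x - y|} ->
  m1 <= e1 -> m2 <= e2 -> e1 <= e2 -> m1 <= m2 ->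
  g (e1 - m1) + m1 <= g (e2 - m2) + m2.
Proof.
move=> gh gl me1 me2 e12 m12.
have i1 : e1 - m1 \in `[0, +oo[ by rewrite in_itv/= andbT subr_ge0.
have i2 : e2 - m2 \in `[0, +oo[ by rewrite in_itv/= andbT subr_ge0.
have [h|/ltW h] := leP (e1 - m1) (e2 - m2); first exact: lerD (gh _ _ i1 i2 h) m12.
have := gl _ _ i1 i2; rewrite [`|e1 - _ - _|]ger0_norm ?subr_ge0// ler_norml.
by case/andP => _; lra.
Qed.

Lemma equal_in_law_ES X Y : equal_in_law P X Y -> ES P p X = ES P p Y.
Proof.
move=> XY; rewrite /ES; congr (_ * _); apply: eq_Rintegral => s _.
rewrite /VaR; congr (inf _); apply/seteqP.
have XYx x : (P [set w | X w <= x] = P [set w | Y w <= x])%R.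
  exact: (XY _ (measurable_itv `]-oo, x])).
by split=> x /=; rewrite XYx.
Qed.

Lemma equal_in_law_mean X Y : equal_in_law P X Y -> mean P X = mean P Y.
Proof.
move=> XY; rewrite /mean unlock; congr fine.
rewrite -(integral_distribution (X := X) (f := EFin))//; last exact: Lq_integrable.
rewrite -(integral_distribution (X := Y) (f := EFin))//; last exact: Lq_integrable.
apply: eq_measure_integral => A mA _; exact: XY.
Qed.

Lemma mean_Lq_add X Y : mean P (X + Y) = mean P X + mean P Y.
Proof. by rewrite -meanD//; exact: Lq_integrable. Qed.

Lemma mean_Lq_cst c : mean P (Lq_cst c : Lq) = c.
Proof. exact: mean_cst. Qed.

Lemma mean_ES_form_risk rho : mean_ES_form p rho ->
  [/\ monotone_risk rho, translation_invariant rho,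
      concentration_averse p rho & rho 0 = 0].
Proof.
move=> [g [gh gl g0 rhoE]].
have LL := Lq_integrable.
have homo X Y : ES P p X <= ES P p Y -> mean P X <= mean P Y -> rho X <= rho Y.
  by move=> eXY mXY; rewrite !rhoE; apply: mean_ES_homo => //;
    exact: (ES_ge_mean atomlessP p01 (LL _)).
split.
- move=> X Y XY; apply: homo.
    exact: (ES_mono atomlessP p01 (LL X) (LL Y)).
  exact: (mean_le (LL X) (LL Y)).
- move=> X c; rewrite !rhoE mean_Lq_add mean_Lq_cst.
  rewrite (ES_shift atomlessP p01 (LL X) (LL (X + Lq_cst c)) (c := c))//.
  by rewrite addrA; congr (g _ + _ + _); ring.
- move=> X Y X' Y' [A [tX tY]] XX' YY'; apply: homo; last first.
    by rewrite !mean_Lq_add (equal_in_law_mean XX') (equal_in_law_mean YY').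
  (* Subadditivity gives the first bound. On the common tail event [A], both expected shortfalls are
     means over [A], and their sum is one of the means bounded by [ES P p (X' + Y')]. *)
  apply: (@le_trans _ _ (ES P p X + ES P p Y)).
    exact: (ES_subadd atomlessP p01 (LL X) (LL Y) (LL (X + Y))).
  rewrite (equal_in_law_ES XX') (equal_in_law_ES YY').
  have p1 : 0 < 1 - p by rewrite subr_gt0; case/andP: p01.
  rewrite -(ler_pM2l p1) mulrDr -(tail_event_mean atomlessP p01 (LL X') tX).
  rewrite -(tail_event_mean atomlessP p01 (LL Y') tY).
  case: tX => -[mA _ _] PA.
  rewrite -(meanD (integrable_mul_indic mA (LL X')) (integrable_mul_indic mA (LL Y'))).
  under eq_fun do rewrite -mulrDl.
  by apply: (mean_mul_indic_le_ES p01 (LL (X' + Y')) mA); rewrite /pr PA.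
- rewrite rhoE (_ : mean P _ = 0); last exact: mean_cst.
  rewrite addr0 subr0 -[RHS]g0; congr g; apply/eqP; rewrite eq_le; apply/andP; split.
    have p1 : 0 < 1 - p by rewrite subr_gt0; case/andP: p01.
    rewrite -(ler_pM2l p1); apply: le_trans (ES_le_excess atomlessP p01 0 (LL _)) _.
    rewrite mulr0 add0r -[leRHS](mean_cst P) le_eqVlt; apply/orP; left.
    by apply/eqP; congr (mean P _); apply/funext => w; rewrite /= subr0 maxxx.
  rewrite -[leLHS](mean_cst P); exact: (ES_ge_mean atomlessP p01 (LL 0)).
Qed.

(** Two kinds of test functions suffice: the identity compares the means, and the excess over
    [VaR P p Y] compares the expected shortfalls, as [ES_le_excess] is an equality for [Y] at that
    level. *)
Lemma SSD_consistent_mean_ES rho : mean_ES_form p rho -> SSD_consistent rho.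
Proof.
move=> [g [gh gl g0 rhoE]] X Y XY.
have iX := Lq_integrable X; have iY := Lq_integrable Y.
have p1 : 0 < 1 - p by rewrite subr_gt0; case/andP: p01.
rewrite !rhoE; apply: mean_ES_homo => //;
  try exact: (ES_ge_mean atomlessP p01 (Lq_integrable _)).
- rewrite -(ler_pM2l p1); apply: le_trans (ES_le_excess atomlessP p01 (VaR P p Y) iX) _.
  rewrite ES_VaRE// lerD2l fine_le//;
    try exact/expectation_fin_num/Lfun1_integrable/integrable_excess.
  apply: (XY (fun x => Num.max (x - VaR P p Y) 0)) => [x y xy|];
    last exact: convex_excess.
  by rewrite /= ge_max !le_max lerD2r xy lexx !orbT.
- rewrite fine_le//; try exact/expectation_fin_num/Lfun1_integrable.
  by apply: (XY id) => // a x y _ _.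
Qed.

End mean_ES_risk.

(** * Membership in [Lq] and dominated convergence in norm *)

Section Lq_functions.
Context {d : measure_display} {T : measurableType d} {R : realType}.
Context {P : probability T R} {q : R} {q1 : (1 <= q%:E)%E}.
Local Notation Lq := (LfunType P q1).
Local Notation inL f := ((f : T -> R) \in Lfun P q%:E).
Implicit Types (f g : T -> R).

(* A total retraction onto [Lq], junk ([0]) outside of it. *)
Definition Lq_of f : Lq :=
  if pselect (inL f) is left h then Lfun_Sub q1 h else 0.

Lemma Lq_ofE f : inL f -> Lq_of f = f :> (T -> R).
Proof. by rewrite /Lq_of; case: pselect. Qed.

Lemma Lfun_add f g : inL f -> inL g -> inL (fun w => f w + g w).
Proof. by move=> hf hg; exact: (LfunP (Lfun_Sub q1 hf + Lfun_Sub q1 hg)). Qed.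

Lemma Lfun_mulc c f : inL f -> inL (fun w => c * f w).
Proof. by move=> hf; exact: (LfunP (c *: Lfun_Sub q1 hf)). Qed.

Lemma Lfun_const c : inL (fun=> c).
Proof. exact: Lfun_cst. Qed.

Lemma Lfun_measurable f : inL f -> measurable_fun [set: T] f.
Proof. by move=> /sub_Lfun_mfun /set_mem. Qed.

Let q_ge1 : 1 <= q. Proof. by rewrite -lee_fin. Qed.
Let q_gt0 : 0 < q. Proof. exact: lt_le_trans q_ge1. Qed.

Lemma Lfun_dominated f g : measurable_fun [set: T] f -> inL g ->
  (forall w, `|f w| <= `|g w|) -> inL f.
Proof.
move=> mf hg fg; rewrite inE; apply/andP; split; rewrite inE//=.
rewrite /finite_norm unlock poweR_lty//; apply: integrable_lty => //.
apply: le_integrable (Lfun_integrable q_ge1 hg) => //.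
  apply/measurable_EFinP.
  apply: (@measurableT_comp _ _ _ _ _ _ (@powR R ^~ q)) => //.
  exact: measurableT_comp.
move=> w _ /=; rewrite lee_fin [leLHS]ger0_norm ?powR_ge0//.
by rewrite [leRHS]ger0_norm ?powR_ge0// ge0_ler_powR ?nnegrE// ltW.
Qed.

Lemma Lfun_mul_indic f B : measurable B -> inL f -> inL (fun w => f w * \1_B w).
Proof.
move=> mB hf; apply: (Lfun_dominated _ hf) => [|w].
  by apply: measurable_funM => //; exact: Lfun_measurable.
rewrite normrM ler_piMr// indicE.
by case: (_ \in _); rewrite ?normr1 ?normr0.
Qed.

Lemma Lfun_indic c B : measurable B -> inL (fun w => c * \1_B w).
Proof. by move=> mB; apply: Lfun_mul_indic => //; exact: Lfun_const. Qed.

Lemma Lq_add_of f g : inL f -> inL g ->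
  Lq_of f + Lq_of g = Lq_of (fun w => f w + g w).
Proof.
move=> hf hg; apply/LfuneqP => w; rewrite Lq_ofE; last exact: Lfun_add.
by rewrite -[in RHS](Lq_ofE hf) -[in RHS](Lq_ofE hg).
Qed.

(** Dominated convergence is applied to the [q]-th powers of the absolute values, below the
    threshold [e] to the power [q]. *)
Lemma dominated_Lnorm (f_ : (T -> R)^nat) g (e : R) : 
  (forall n, measurable_fun [set: T] (f_ n)) -> inL g ->
  (forall n w, `|f_ n w| <= `|g w|) ->
  (forall w, f_ n w @[n --> \oo] --> (0 : R)) -> 0 < e ->
  \forall n \near \oo, ('N[P]_q%:E[EFin \o f_ n] < e%:E)%E.
Proof.
move=> mf hg fg f0 e0.
have powq_cvg w : `|f_ n w| `^ q @[n --> \oo] --> (0 : R).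
  apply/cvgrPdist_lt => eps eps0.
  have eps'0 : 0 < eps `^ q^-1 by rewrite powR_gt0.
  move/cvgrPdist_lt : (f0 w) => /(_ _ eps'0); apply: filterS => n.
  rewrite !sub0r !normrN [in X in _ -> X]ger0_norm ?powR_ge0// => lt.
  rewrite -[ltRHS](@powRr1 _ eps) ?ltW// -(mulVf (lt0r_neq0 q_gt0)) powRrM.
  by rewrite gt0_ltr_powR// nnegrE// ltW.
have := @dominated_cvg _ _ _ P setT measurableT
  (fun n w => (`|f_ n w| `^ q)%:E) (cst 0%E) (fun w => (`|g w| `^ q)%:E).
rewrite integral0 => /(_ _ _ _ _ _) h.
have eq0 : 0 < e `^ q by rewrite powR_gt0.
have : nbhs 0%E [set u | (u < (e `^ q)%:E)%E].
  by apply: open_ereal_lt'; rewrite lte_fin.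
move/h => [].
- move=> n; apply/measurable_EFinP.
  apply: (@measurableT_comp _ _ _ _ _ _ (@powR R ^~ q)) => //.
  exact: measurableT_comp.
- move=> w _; apply: cvg_EFin; first exact: nearW.
  exact: powq_cvg.
- by [].
- exact: Lfun_integrable.
- move=> n w _; rewrite /= lee_fin [leLHS]ger0_norm ?powR_ge0//.
  by rewrite ge0_ler_powR ?nnegrE// ltW.
move=> N _ hN; exists N => // n /hN /=.
apply: contraTT; rewrite -!leNgt => le.
rewrite [leRHS](_ : _ = 'N[P]_q%:E[EFin \o f_ n] `^ q)%E; last first.
  by rewrite poweR_Lnorm ?gt_eqF.
rewrite -poweR_EFin; apply: gt0_ler_poweR => //; first exact: ltW.
- by rewrite in_itv/= leey lee_fin ltW.
- by rewrite in_itv/= leey Lnorm_ge0.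
Qed.

End Lq_functions.

(** * Necessity: concentration aversion determines [rho] *)

Section concentration_averse.
Context {d : measure_display} {T : measurableType d} {R : realType}.
Context {P : probability T R} {q : R} {q1 : (1 <= q%:E)%E}.
Local Notation Lq := (LfunType P q1).
Local Notation inL f := ((f : T -> R) \in Lfun P q%:E).
Local Notation Lqf := (@Lq_of _ _ _ P q q1).
Variables (p : R) (rho : Lq -> R).
Hypotheses (atomlessP : atomless P) (p01 : 0 < p < 1).
Hypotheses (rhoM : monotone_risk rho) (rhoTI : translation_invariant rho).
Hypothesis rhoCA : concentration_averse p rho.
Implicit Types (f g W : T -> R) (A B E : set T).

Let p0 : 0 < p. Proof. by case/andP: p01. Qed.
Let p1 : 0 < 1 - p. Proof. by rewrite subr_gt0; case/andP: p01. Qed.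

(** Plain functions can be rewritten pointwise; the value is meaningful only for members of [Lq]. *)
Let r f := rho (Lqf f).

Let inLD f g : inL f -> inL g -> inL (fun w => f w + g w).
Proof. exact: (Lfun_add (q1 := q1)). Qed.

Let inL_indic c B : measurable B -> inL (fun w => c * \1_B w).
Proof. exact: (Lfun_indic (q1 := q1)). Qed.

Lemma risk_shift f c : inL f -> r (fun w => f w + c) = r f + c.
Proof.
move=> hf; rewrite /r -rhoTI; congr rho; apply/LfuneqP => w.
rewrite Lq_ofE; last exact: inLD hf (Lfun_const c).
by rewrite -[in LHS](Lq_ofE (q1 := q1) hf).
Qed.

Lemma risk_mono f g : inL f -> inL g -> (forall w, f w <= g w) -> r f <= r g.
Proof. by move=> hf hg fg; apply: rhoM => w; rewrite !Lq_ofE. Qed.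

Lemma risk_lipschitz f g (e : R) : inL f -> inL g ->
  (forall w, `|f w - g w| <= e) -> `|r f - r g| <= e.
Proof.
move=> hf hg fg; rewrite ler_distl; apply/andP; split.
  rewrite lerBlDr -risk_shift//; apply: risk_mono => // [|w].
    exact: inLD hf (Lfun_const e).
  by have := fg w; rewrite ler_distl => /andP[]; lra.
rewrite -risk_shift//; apply: risk_mono => // [|w].
  exact: inLD hg (Lfun_const e).
by have := fg w; rewrite ler_distl => /andP[]; lra.
Qed.

(** A pointwise strengthening of the tail-event condition, free of null sets and stable under
    sums. *)
Definition tail_on A W := inL W /\ forall w w', A w -> ~ A w' -> W w' <= W w.

Lemma tail_onD A f g : tail_on A f -> tail_on A g ->
  tail_on A (fun w => f w + g w).
Proof.
move=> [hf tf] [hg tg]; split; first exact: inLD.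
by move=> w w' Aw Aw'; rewrite lerD ?tf ?tg.
Qed.

Lemma tail_on_event A W : measurable A -> pr P A = 1 - p -> tail_on A W ->
  p_tail_event P p (Lqf W) A.
Proof.
move=> mA pA [hW tW]; rewrite /p_tail_event /tail_event prE// pA !lte_fin p1.
rewrite ltrBlDr ltrDl p0; split=> //; split=> //.
by apply: aeW => w Aw; apply: aeW => w' Aw'; rewrite Lq_ofE//; exact: tW.
Qed.

Lemma equal_in_law_of f g : inL f -> inL g ->
  (forall C, measurable C -> P (f @^-1` C) = P (g @^-1` C)) ->
  equal_in_law P (Lqf f) (Lqf g).
Proof.
move=> hf hg fg C mC.
have preE h : inL h -> (Lqf h : T -> R) @^-1` C = h @^-1` C.
  by move=> hh; rewrite Lq_ofE.
by have := fg C mC; rewrite -(preE f)// -(preE g).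
Qed.

Lemma risk_concentrated A f g f' g' : measurable A -> pr P A = 1 - p ->
  tail_on A f' -> tail_on A g' -> inL f -> inL g ->
  (forall C, measurable C -> P (f @^-1` C) = P (f' @^-1` C)) ->
  (forall C, measurable C -> P (g @^-1` C) = P (g' @^-1` C)) ->
  r (fun w => f w + g w) <= r (fun w => f' w + g' w).
Proof.
move=> mA pA tf' tg' hf hg ff' gg'.
have [[hf' _] [hg' _]] := (tf', tg').
rewrite /r -!Lq_add_of//; apply: rhoCA; try exact: equal_in_law_of.
by exists A; split; exact: tail_on_event.
Qed.

Lemma preimage_scaled_indic (s : R) B B' (C : set R) : measurable B -> measurable B' ->
  pr P B = pr P B' ->
  P ((fun w => s * \1_B w) @^-1` C) = P ((fun w => s * \1_B' w) @^-1` C).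
Proof.
move=> mB mB' BB'.
pose D : set R := *%R s @^-1` C.
have preD A : (fun w => s * \1_A w) @^-1` C = \1_A @^-1` D by [].
rewrite !preD !preimage_indic.
case: ifP => _; case: ifP => _ //; rewrite !prE ?BB'//; try exact: measurableC.
by rewrite !prC// BB'.
Qed.

(* The factors [s] by which indicators of subsets of [E], one of the two sides
   of [A], may be multiplied to have [A] as a tail event. *)
Definition side A E (s : R) := (E = A /\ 0 <= s) \/ (E = ~` A /\ s <= 0).

Lemma side_scale A E s c : 0 <= c -> side A E s -> side A E (c * s).
Proof.
move=> c0 [[-> s0]|[-> s0]]; [left|right]; split=> //.
  exact: mulr_ge0.
exact: mulr_ge0_le0.
Qed.

Lemma tail_on_side A E s B : side A E s -> measurable B -> B `<=` E ->
  tail_on A (fun w => s * \1_B w).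
Proof.
move=> sE mB BE; split; first exact: inL_indic.
move=> w w' Aw Aw'; case: sE BE => -[-> s0] BE; rewrite !indicE.
  rewrite [w' \in B]memNset ?mulr0; last by move=> /BE.
  by rewrite mulr_ge0.
rewrite [w \in B]memNset ?mulr0; last by move=> /BE.
exact: mulr_le0_ge0.
Qed.

Lemma risk_swap A E W s B B' : measurable A -> pr P A = 1 - p ->
  tail_on A W -> side A E s -> measurable B -> B `<=` E ->
  measurable B' -> B' `<=` E -> pr P B = pr P B' ->
  r (fun w => W w + s * \1_B w) = r (fun w => W w + s * \1_B' w).
Proof.
move=> mA pA tW sE mB BE mB' B'E BB'.
have hW := proj1 tW.
apply/eqP; rewrite eq_le; apply/andP; split.
  apply: (risk_concentrated mA pA) => // [||C mC].
  - exact: tail_on_side sE _ _.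
  - exact: inL_indic.
  - exact: preimage_scaled_indic.
apply: (risk_concentrated mA pA) => // [||C mC].
- exact: tail_on_side sE _ _.
- exact: inL_indic.
- exact: preimage_scaled_indic.
Qed.

Lemma indicU B B' w : B `&` B' = set0 ->
  \1_(B `|` B') w = \1_B w + \1_B' w :> R.
Proof.
move=> BB'; rewrite !indicE in_setU.
have [/set_mem Bw|_] := boolP (w \in B); last by rewrite add0r.
rewrite memNset ?addr0// => B'w.
by have : (B `&` B') w by []; rewrite BB'.
Qed.

(* Binary expansion of [pr B / pr E]: half of the mass of [s * \1_B] is moved
   off [B] as far as [E] allows, which leaves a multiple of [\1_E] and a piece
   of height [s / 2]. *)
Lemma risk_spread_approx A E n W s B : measurable A -> pr P A = 1 - p ->
  measurable E -> 0 < pr P E ->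
  tail_on A W -> side A E s -> measurable B -> B `<=` E ->
  `|r (fun w => W w + s * \1_B w) -
    r (fun w => W w + s * (pr P B / pr P E) * \1_E w)| <= `|s| * 2^-1 ^+ n.
Proof.
move=> mA pA mE E0.
have half t : side A E t -> side A E (t / 2).
  by rewrite mulrC; apply: side_scale.
elim: n W s B => [|n ih] W s B tW sE mB BE; have hW := proj1 tW.
  rewrite expr0 mulr1; apply: risk_lipschitz => [||w].
  - exact: inLD hW (inL_indic _ _).
  - exact: inLD hW (inL_indic _ _).
  rewrite opprD addrACA subrr add0r -mulrA -mulrBr normrM ler_piMr//.
  (* Without any splitting, both functions add to [W] a height between 0 and [s]. *)
  have x0 : 0 <= pr P B / pr P E by rewrite divr_ge0// pr_ge0.
  have x1 : pr P B / pr P E <= 1 by rewrite ler_pdivrMr// mul1r le_pr.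
  rewrite !indicE; have [/set_mem Bw|_] := boolP (w \in B).
    rewrite mem_set; last exact: BE.
    by rewrite mulr1 ger0_norm ?subr_ge0// lerBlDr lerDl.
  by case: (w \in E); rewrite ?mulr1 ?mulr0 ?subrr ?normr0// sub0r normrN ger0_norm.
have tB : tail_on A (fun w => s / 2 * \1_B w).
  exact: tail_on_side (half _ sE) _ _.
have splitB : (fun w => W w + s * \1_B w) =
    (fun w => (W w + s / 2 * \1_B w) + s / 2 * \1_B w).
  by apply/funext => w; field.
have bound : `|s / 2| * 2^-1 ^+ n = `|s| * 2^-1 ^+ n.+1.
  by rewrite exprS mulrA normrM [`|2^-1|]ger0_norm.
have mEB : measurable (E `\` B) by exact: measurableD.
have [small|big] := leP (pr P B) (pr P E / 2).
  (* A disjoint copy [B'] of [B] fits into [E]: moving half of the height there leaves [s / 2] on a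
     set of twice the probability. *)
  have [|B' [mB' B'E BB']] := sierpinski atomlessP (t := pr P B) mEB.
    by rewrite prD// pr_ge0/=; lra.
  have disj : B `&` B' = set0 by apply/seteqP; split=> // w [+ /B'E[]].
  have B'E' : B' `<=` E by move=> w /B'E[].
  rewrite splitB (risk_swap mA pA (tail_onD tW tB) (half _ sE) mB BE mB' B'E')//.
  have -> : (fun w => W w + s / 2 * \1_B w + s / 2 * \1_B' w) =
      (fun w => W w + s / 2 * \1_(B `|` B') w).
    by apply/funext => w; rewrite indicU// mulrDr addrA.
  have := ih W _ _ tW (half _ sE) (measurableU _ _ mB mB').
  rewrite bound prU// BB' => /(_ _).
  have -> : s / 2 * ((pr P B + pr P B) / pr P E) = s * (pr P B / pr P E).
    by field; rewrite gt_eqF.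
  by apply; move=> w [/BE|/B'E'].
(* One half-height layer stays on [B]; the other moves to [E] minus [B], topped up by [C] inside [B]
   to keep its probability. The sum is [s / 2] on all of [E], absorbed in [W], plus [s / 2] on
   [C]. *)
have [|C [mC CB Cp]] := sierpinski atomlessP (t := pr P B *+ 2 - pr P E) mB.
  by have := le_pr P mB mE BE; rewrite mulr2n; lra.
have disj : (E `\` B) `&` C = set0 by apply/seteqP; split=> // w [[_ +] /CB].
have mB' : measurable ((E `\` B) `|` C) by exact: measurableU.
have B'E : (E `\` B) `|` C `<=` E by move=> w [[]//|/CB/BE].
have CE : C `<=` E by move=> w /CB/BE.
rewrite splitB (risk_swap mA pA (tail_onD tW tB) (half _ sE) mB BE mB' B'E); last first.
  by rewrite prU// prD// Cp mulr2n; lra.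
have tE : tail_on A (fun w => s / 2 * \1_E w).
  exact: tail_on_side (half _ sE) _ _.
have -> : (fun w => W w + s / 2 * \1_B w + s / 2 * \1_((E `\` B) `|` C) w) =
    (fun w => (W w + s / 2 * \1_E w) + s / 2 * \1_C w).
  apply/funext => w; rewrite indicU// -{2}(setDUK BE) indicU ?setDIK//; ring.
have := ih _ _ _ (tail_onD tW tE) (half _ sE) mC CE.
rewrite bound Cp.
have -> : (fun w => W w + s / 2 * \1_E w +
      s / 2 * ((pr P B *+ 2 - pr P E) / pr P E) * \1_E w) =
    (fun w => W w + s * (pr P B / pr P E) * \1_E w).
  by apply/funext => w; rewrite mulr2n; field; rewrite gt_eqF.
by [].
Qed.

Lemma risk_spread A E W s B : measurable A -> pr P A = 1 - p ->
  measurable E -> 0 < pr P E ->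
  tail_on A W -> side A E s -> measurable B -> B `<=` E ->
  r (fun w => W w + s * \1_B w) =
  r (fun w => W w + s * (pr P B / pr P E) * \1_E w).
Proof.
move=> mA pA mE E0 tW sE mB BE.
apply/eqP; rewrite -subr_eq0 -normr_le0.
have h n := risk_spread_approx n mA pA mE E0 tW sE mB BE.
have lim : `|s| * 2^-1 ^+ n @[n --> \oo] --> `|s| * 0.
  by apply: cvgMr; apply: cvg_expr; rewrite ger0_norm// invf_lt1// ltr1n.
rewrite mulr0 in lim; rewrite -(cvg_lim _ lim)//.
apply: limr_ge; first by apply/cvg_ex; exists 0.
by apply: nearW => n; exact: h.
Qed.

Lemma risk_spread_sum A E W (s : R) (l : seq (R * set T)) :
  measurable A -> pr P A = 1 - p -> measurable E -> 0 < pr P E ->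
  tail_on A W -> side A E s ->
  (forall x, x \in l -> [/\ 0 <= x.1, measurable x.2 & x.2 `<=` E]) ->
  r (fun w => W w + s * \sum_(x <- l) x.1 * \1_(x.2) w) =
  r (fun w => W w + s * (\sum_(x <- l) x.1 * pr P x.2 / pr P E) * \1_E w).
Proof.
move=> mA pA mE E0 tW sE; elim: l W tW => [|[c B] l ih] W tW hl.
  by congr r; apply/funext => w; rewrite !big_nil !mulr0 mul0r.
have [/= c0 mB BE] : [/\ 0 <= (c, B).1, measurable (c, B).2 & (c, B).2 `<=` E].
  by apply: hl; rewrite mem_head.
have hl' x : x \in l -> [/\ 0 <= x.1, measurable x.2 & x.2 `<=` E].
  by move=> xl; apply: hl; rewrite inE xl orbT.
have scE : side A E (s * c) by rewrite mulrC; exact: side_scale.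
have tB : tail_on A (fun w => s * c * \1_B w) by exact: tail_on_side scE _ _.
set S := \sum_(x <- l) x.1 * pr P x.2 / pr P E.
have tg : tail_on A (fun w => s * S * \1_E w).
  apply: tail_on_side mE (@subset_refl _ E); rewrite mulrC; apply: side_scale => //.
  rewrite /S big_seq; apply: sumr_ge0 => x xl; have [x0 _ _] := hl' x xl.
  by rewrite divr_ge0 ?mulr_ge0 ?pr_ge0.
(* The head is absorbed in [W] while the rest is spread; then the spread rest is absorbed while the
   head is spread. *)
transitivity (r (fun w => (W w + s * c * \1_B w) +
    s * \sum_(x <- l) x.1 * \1_(x.2) w)).
  by congr r; apply/funext => w; rewrite big_cons/=; ring.
rewrite (ih _ (tail_onD tW tB) hl') -/S.
transitivity (r (fun w => (W w + s * S * \1_E w) + s * c * \1_B w)).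
  by congr r; apply/funext => w; ring.
rewrite (risk_spread mA pA mE E0 (tail_onD tW tg) scE mB BE).
by congr r; apply/funext => w; rewrite big_cons/= -/S; field; rewrite gt_eqF.
Qed.

Import HBNNSimple.

Lemma risk_spread_nnsfun A E W (s : R) (f : {nnsfun T >-> R}) :
  measurable A -> pr P A = 1 - p -> measurable E -> 0 < pr P E ->
  tail_on A W -> side A E s -> (forall w, ~ E w -> f w = 0) ->
  r (fun w => W w + s * f w) = r (fun w => W w + s * (mean P f / pr P E) * \1_E w).
Proof.
move=> mA pA mE E0 tW sE f0.
(* Cutting with [E] affects only the level set of 0, since [f] vanishes off [E]. *)
pose l := [seq (y, f @^-1` [set y] `&` E) | y <- finmap.enum_fset (fset_set (range f))].
have lE x : x \in l -> [/\ 0 <= x.1, measurable x.2 & x.2 `<=` E].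
  case/mapP => y; rewrite in_fset_set// => /set_mem[w _ <-] ->/=; split=> //.
  exact: measurableI.
have fE w : f w = \sum_(x <- l) x.1 * \1_x.2 w.
  rewrite big_map; under eq_bigr do rewrite /= indicI mulrA.
  rewrite -big_distrl/= -(fsbig_finite _ (fun y => y * \1_(f @^-1` [set y]) w))//.
  rewrite -fimfunE indicE; have [_|/negP nE] := boolP (w \in E); first by rewrite mulr1.
  by rewrite mulr0 f0// => /mem_set.
have i1 c B : measurable B -> P.-integrable [set: T] (EFin \o (fun w => c * \1_B w)).
  by move=> mB; apply: integrable_mul_indic => //; exact: integrable_const.
have [_ mean_l] : P.-integrable [set: T] (EFin \o (fun w => \sum_(x <- l) x.1 * \1_x.2 w)) /\
    mean P (fun w => \sum_(x <- l) x.1 * \1_x.2 w) = \sum_(x <- l) x.1 * pr P x.2.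
  elim: {fE} l lE => [|[c B] l ih] lE.
    have -> : (fun w => \sum_(x <- [::] : seq (R * set T)) x.1 * \1_x.2 w) = fun=> 0.
      by apply/funext => w; rewrite big_nil.
    by rewrite big_nil mean_cst; split=> //; exact: integrable_const.
  have [|il ml] := ih; first by move=> x xl; apply: lE; rewrite inE xl orbT.
  have [/= _ mB _] : [/\ 0 <= (c, B).1, measurable (c, B).2 & (c, B).2 `<=` E].
    by apply: lE; rewrite mem_head.
  have -> : (fun w => \sum_(x <- (c, B) :: l) x.1 * \1_x.2 w) =
      fun w => c * \1_B w + \sum_(x <- l) x.1 * \1_x.2 w.
    by apply/funext => w; rewrite big_cons.
  split; first by apply: integrable_add => //; exact: i1.
  rewrite meanD ?ml//; last exact: i1.
  by rewrite big_cons/= meanZ ?mean_indic//; exact: integrable_indic1.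
have fE' : (f : T -> R) = fun w => \sum_(x <- l) x.1 * \1_x.2 w by exact/funext.
have := risk_spread_sum mA pA mE E0 tW sE lE.
by rewrite -mulr_suml -mean_l fE'.
Qed.

Lemma nnsfun_approx_mean f : inL f -> (forall w, 0 <= f w) ->
  exists f_ : {nnsfun T >-> R}^nat,
    [/\ forall n w, f_ n w <= f w,
        forall w, f_ n w @[n --> \oo] --> f w &
        mean P (f_ n) @[n --> \oo] --> mean P f].
Proof.
move=> hf f0.
have mf : measurable_fun [set: T] (EFin \o f).
  by apply/measurable_EFinP; exact: (@Lfun_measurable _ _ _ P q).
have if_ : P.-integrable [set: T] (EFin \o f).
  by have := Lq_integrable (Lfun_Sub q1 hf).
pose f_ := nnsfun_approx measurableT mf.
have le n w : f_ n w <= f w.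
  rewrite -lee_fin (nnsfun_approxE measurableT mf n).
  by apply: (@le_approx _ _ _ _ (EFin \o f)) => // x _; rewrite lee_fin.
have cv w : f_ n w @[n --> \oo] --> f w.
  have := cvg_nnsfun_approx measurableT mf 
    (fun x _ => f0 x : (0 <= (EFin \o f) x)%E) (I : setT w).
  by move=> /fine_cvg.
exists f_; split=> //.
rewrite /mean unlock; apply: fine_cvg; rewrite fineK ?integrable_fin_num//.
apply: (@dominated_cvg _ _ _ P setT measurableT (fun n w => (f_ n w)%:E)
  (EFin \o f) (EFin \o f)) => //.
- by move=> n; apply/measurable_EFinP.
- by move=> w _; apply: cvg_EFin; [exact: nearW|exact: cv].
- by move=> n w _; rewrite /= lee_fin ger0_norm.
Qed.

Hypothesis rhoC : Lq_continuous rho.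

(** Here [X - v] is a nonnegative part on [A] minus a nonnegative part off [A]. Simple functions
    approximate each part and are spread over its side; the limit uses continuity in norm for the
    approximations of [X], and the sup-norm Lipschitz bound for the two-valued functions. *)
Lemma risk_spread_tail (X : Lq) A (v : R) : measurable A -> pr P A = 1 - p ->
  (forall w, A w -> v <= X w) -> (forall w, ~ A w -> X w <= v) ->
  rho X = v + r (fun w =>
    mean P (fun w => (X w - v) * \1_A w) / (1 - p) * \1_A w +
    - (mean P (fun w => (v - X w) * \1_(~` A) w) / p) * \1_(~` A) w).
Proof.
move=> mA pA AX XA.
have mA' : measurable (~` A) by exact: measurableC.
have pA' : pr P (~` A) = p by rewrite prC// pA; lra.
have hX : inL (X : T -> R) by exact: LfunP.
set X1 := fun w => (X w - v) * \1_A w.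
set X2 := fun w => (v - X w) * \1_(~` A) w.
have hXv : inL (fun w => X w - v) by exact: inLD hX (Lfun_const (- v)).
have hX1 : inL X1 by exact: (Lfun_mul_indic (q1 := q1)).
have hvX : inL (fun w => v - X w).
  apply: inLD (Lfun_const v) _; have := Lfun_mulc (q1 := q1) (-1) hX.
  by under eq_fun do rewrite mulN1r.
have hX2 : inL X2 by exact: (Lfun_mul_indic (q1 := q1)).
have X10 w : 0 <= X1 w.
  rewrite /X1 indicE; have [/set_mem Aw|_] := boolP (w \in A); last by rewrite mulr0.
  by rewrite mulr1 subr_ge0 AX.
have X20 w : 0 <= X2 w.
  rewrite /X2 indicE; have [/set_mem Aw|_] := boolP (w \in ~` A); last by rewrite mulr0.
  by rewrite mulr1 subr_ge0 XA.
have X1A w : ~ A w -> X1 w = 0.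
  by move=> Aw; rewrite /X1 indicE memNset// mulr0.
have X2A w : ~ (~` A) w -> X2 w = 0.
  by move=> Aw; rewrite /X2 indicE memNset// mulr0.
have XE w : X w = X1 w - X2 w + v.
  rewrite /X1 /X2 !indicE in_setC; case: (w \in A) => /=; rewrite ?mulr1 ?mulr0; ring.
set a := mean P X1 / _; set b := mean P X2 / _.
set V := fun w => a * \1_A w + - b * \1_(~` A) w.
have [f_ [f_le f_cvg mf_]] := nnsfun_approx_mean hX1 X10.
have [h_ [h_le h_cvg mh_]] := nnsfun_approx_mean hX2 X20.
have hf n : inL (f_ n).
  by apply: (Lfun_dominated (q1 := q1) _ hX1) => // w; rewrite !ger0_norm.
have hh n : inL (h_ n).
  by apply: (Lfun_dominated (q1 := q1) _ hX2) => // w; rewrite !ger0_norm.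
have f_A n w : ~ A w -> f_ n w = 0.
  by move=> Aw; apply/eqP; rewrite eq_le -{1}(X1A w Aw) f_le/=.
have h_A n w : ~ (~` A) w -> h_ n w = 0.
  by move=> Aw; apply/eqP; rewrite eq_le -{1}(X2A w Aw) h_le/=.
pose Y n w := f_ n w - h_ n w + v.
pose V_ n w := mean P (f_ n) / (1 - p) * \1_A w + - (mean P (h_ n) / p) * \1_(~` A) w.
have hV c e : inL (fun w => c * \1_A w + - e * \1_(~` A) w).
  by apply: inLD; exact: inL_indic.
have hfh n : inL (fun w => f_ n w - h_ n w).
  apply: inLD (hf n) _; have := Lfun_mulc (q1 := q1) (-1) (hh n).
  by under eq_fun do rewrite mulN1r.
have hY n : inL (Y n) by exact: inLD (hfh n) (Lfun_const v).
have rY n : r (Y n) = r (V_ n) + v.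
  rewrite risk_shift//; congr (_ + _).
  (* First [f_ n] is spread over [A] with [- h_ n] as the fixed summand, then [h_ n] over the
     complement with the spread part fixed. *)
  have th : tail_on A (fun w => - h_ n w).
    split; first by have := Lfun_mulc (q1 := q1) (-1) (hh n);
      under eq_fun do rewrite mulN1r.
    by move=> w w' Aw Aw'; rewrite (h_A n w)// oppr0 oppr_le0.
  have sA : side A A 1 by left; split.
  have sA' : side A (~` A) (-1) by right; split.
  transitivity (r (fun w => - h_ n w + 1 * f_ n w)).
    by congr r; apply/funext => w; rewrite mul1r addrC.
  rewrite (risk_spread_nnsfun mA pA mA _ th sA (f_A n)) ?pA//.
  transitivity (r (fun w => 1 * (mean P (f_ n) / (1 - p)) * \1_A w + -1 * h_ n w)).
    by congr r; apply/funext => w; rewrite mulN1r addrC.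
  have tf : tail_on A (fun w => 1 * (mean P (f_ n) / (1 - p)) * \1_A w).
    apply: tail_on_side mA (@subset_refl _ A); rewrite mulrC; apply: side_scale => //.
    rewrite divr_ge0 ?(ltW p1)// -(mean_cst P 0); apply: mean_le => //.
      exact: integrable_const.
    by have := Lq_integrable (Lfun_Sub q1 (hf n)).
  rewrite (risk_spread_nnsfun mA pA mA' _ tf sA' (h_A n)) ?pA'//.
  by congr r; apply/funext => w; rewrite /V_ mul1r mulN1r.
apply/eqP; rewrite -subr_eq0 -normr_le0; apply/ler_addgt0Pr => e e0; rewrite add0r.
have e2 : 0 < e / 2 by rewrite divr_gt0.
have [delta delta0 Hd] := rhoC X e2.
(* On either side of [A], the error [Y n - X] is dominated by [X - v]. *)
have cvY : \forall n \near \oo,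
    ('N[P]_(q%:E)[EFin \o (fun w => Y n w - X w)%R] < delta%:E)%E.
  apply: (dominated_Lnorm (q1 := q1) (g := fun w => X w - v)) => //.
  - by move=> n; apply: measurable_funB => //; exact: (@Lfun_measurable _ _ _ P q).
  - move=> n w; have [Aw|Aw] := pselect (A w).
      have nA : ~ (~` A) w by apply.
      rewrite /Y XE h_A// X2A//.
      have -> : f_ n w - 0 + v - (X1 w - 0 + v) = - (X1 w - f_ n w) by ring.
      have -> : X1 w - 0 + v - v = X1 w by ring.
      by rewrite normrN !ger0_norm ?subr_ge0// lerBlDr lerDl.
    rewrite /Y XE f_A// X1A//.
    have -> : 0 - h_ n w + v - (0 - X2 w + v) = X2 w - h_ n w by ring.
    have -> : 0 - X2 w + v - v = - X2 w by ring.
    by rewrite normrN !ger0_norm ?subr_ge0// lerBlDr lerDl.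
  - move=> w; rewrite (_ : 0 = X1 w - X2 w + v - X w); last by rewrite -XE subrr.
    apply: cvgB; last exact: cvg_cst.
    apply: cvgD; last exact: cvg_cst.
    by apply: cvgB; [exact: f_cvg|exact: h_cvg].
have /cvgrPdist_lt/(_ _ e2) cva : mean P (f_ n) / (1 - p) @[n --> \oo] --> a.
  exact: cvgMl.
have /cvgrPdist_lt/(_ _ e2) cvb : mean P (h_ n) / p @[n --> \oo] --> b.
  exact: cvgMl.
have [n [[Yn an] bn]] : exists n,
    (('N[P]_(q%:E)[EFin \o (fun w => Y n w - X w)%R] < delta%:E)%E /\
     `|a - mean P (f_ n) / (1 - p)| < e / 2) /\ `|b - mean P (h_ n) / p| < e / 2.
  by have := filterI (filterI cvY cva) cvb; case=> N _ /(_ N (leqnn _)) h; exists N.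
have rXY : `|r (Y n) - rho X| < e / 2.
  apply: Hd; rewrite (_ : EFin \o _ = EFin \o (fun w => Y n w - X w)%R)//.
  by apply/funext => w /=; congr EFin; rewrite -[in RHS](Lq_ofE (q1 := q1) (hY n)).
have rV : `|r (V_ n) - r V| <= e / 2.
  apply: risk_lipschitz => [||w]; [exact: hV|exact: hV|].
  rewrite /V_ /V !indicE in_setC; case: (w \in A) => /=;
    rewrite ?mulr1 ?mulr0 ?addr0 ?add0r.
    by rewrite distrC ltW.
  by rewrite -opprD normrN distrC ltW.
have -> : rho X - (v + r V) = (r (Y n) - r V - v) - (r (Y n) - rho X) by ring.
rewrite rY; apply: le_trans (ler_normB _ _) _; rewrite [leRHS](splitr e).
by rewrite lerD ?(ltW rXY)//; [move: rV; congr (`|_| <= _); ring|rewrite -rY ltW].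
Qed.

(** The conditional means of [X] on and off [A] differ by [x / p], and the one off [A] is the mean
    of [X] minus [(1 - p) * (x / p)]; translation invariance extracts the latter. *)
Lemma risk_two_valued (X : Lq) A (v : R) : measurable A -> pr P A = 1 - p ->
  (forall w, A w -> v <= X w) -> (forall w, ~ A w -> X w <= v) ->
  let x := mean P (fun w => X w * \1_A w) / (1 - p) - mean P X in
  rho X = mean P X - (1 - p) * (x / p) + r (fun w => x / p * \1_A w).
Proof.
move=> mA pA AX XA; set e := mean P _ / _ => x.
have mA' : measurable (~` A) by exact: measurableC.
have pA' : pr P (~` A) = p by rewrite prC// pA; lra.
have iX := Lq_integrable X.
have eE : mean P (fun w => X w * \1_A w) = (1 - p) * e.
  by rewrite /e mulrC divfK// gt_eqF.
have a_E : mean P (fun w => (X w - v) * \1_A w) / (1 - p) = e - v.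
  by rewrite mean_mul_indicB// pA eE; field; rewrite gt_eqF.
have mXA' : mean P (fun w => X w * \1_(~` A) w) = mean P X - (1 - p) * e.
  rewrite -eE; apply/eqP; rewrite eq_sym subr_eq; apply/eqP.
  rewrite -meanD; [|exact: integrable_mul_indic..].
  congr (mean P _); apply/funext => w; rewrite -mulrDr !indicE in_setC.
  by case: (_ \in _); rewrite ?addr0 ?add0r mulr1.
have b_E : mean P (fun w => (v - X w) * \1_(~` A) w) / p =
    v - (mean P X - (1 - p) * e) / p.
  have -> : (fun w => (v - X w) * \1_(~` A) w) =
      fun w => -1 * ((X w - v) * \1_(~` A) w).
    by apply/funext => w; ring.
  rewrite meanZ; last first.
    apply: integrable_mul_indic => //.
    by apply: integrable_add => //; exact: integrable_const.
  by rewrite mean_mul_indicB// pA' mXA'; field; rewrite gt_eqF.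
rewrite (risk_spread_tail mA pA AX XA) a_E b_E.
set b := v - (_ / p).
have -> : (fun w => (e - v) * \1_A w + - b * \1_(~` A) w) =
    (fun w => x / p * \1_A w + - b).
  apply/funext => w; rewrite !indicE in_setC /b /x; case: (w \in A) => /=;
  by rewrite ?mulr1 ?mulr0; field; rewrite gt_eqF.
rewrite risk_shift; last exact: inL_indic.
by rewrite /b /x; field; rewrite gt_eqF.
Qed.

(** Concentration aversion with zero as second summand, used in both directions. *)
Lemma risk_indic_law c A B : 0 <= c -> measurable A -> measurable B ->
  pr P A = 1 - p -> pr P B = 1 - p ->
  r (fun w => c * \1_A w) = r (fun w => c * \1_B w).
Proof.
move=> c0.
suff le A' B' : measurable A' -> measurable B' ->
    pr P A' = 1 - p -> pr P B' = 1 - p ->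
    r (fun w => c * \1_A' w) <= r (fun w => c * \1_B' w).
  by move=> mA mB pA pB; apply/eqP; rewrite eq_le !le.
move=> mA mB pA pB.
have t0 : tail_on B' (fun w => c * \1_B' w).
  by apply: tail_on_side mB (@subset_refl _ B'); left.
have tz : tail_on B' (fun=> 0) by split=> //; exact: Lfun_const.
have add0 f : (fun w => f w + 0) = f by apply/funext => w; rewrite addr0.
rewrite -[fun w => c * \1_A' w]add0 -[fun w => c * \1_B' w]add0.
apply: (@risk_concentrated B' (fun w => c * \1_A' w) (fun=> 0)
  (fun w => c * \1_B' w) (fun=> 0) mB pB t0 tz (inL_indic c mA)
  (Lfun_const 0)) => // C mC.
by apply: preimage_scaled_indic; rewrite // pA pB.
Qed.

(** * Slope bounds for the profile of a scaled tail indicator *)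

Section profile.
Variable A0 : set T.
Hypotheses (mA0 : measurable A0) (pA0 : pr P A0 = 1 - p).

Let G c := r (fun w => c * \1_A0 w).

Lemma profile_le c c' : c <= c' -> G c <= G c'.
Proof.
move=> cc'; apply: risk_mono => [||w]; [exact: inL_indic|exact: inL_indic|].
by rewrite ler_wpM2r// indicE.
Qed.

Lemma profile_lip c c' : c <= c' -> G c' - G c <= c' - c.
Proof.
move=> cc'; apply: le_trans (ler_norm _) _.
apply: risk_lipschitz => [||w]; [exact: inL_indic|exact: inL_indic|].
rewrite -mulrBl normrM ger0_norm ?subr_ge0// ler_piMr ?subr_ge0// indicE.
by case: (_ \in _); rewrite ?normr1 ?normr0.
Qed.

(* Concentration aversion compares [c * \1_A0 + delta * \1_B], for [B]
   independent of [A0] and equiprobable with it, to [(c + delta) * \1_A0];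
   [delta <= c] makes [A0] a tail event of the former. *)
Lemma profile_step c delta : 0 <= delta <= c ->
  G c + (1 - p) * delta <= G (c + delta).
Proof.
move=> /andP[d0 dc].
have c0 : 0 <= c by exact: le_trans dc.
have mA0' : measurable (~` A0) by exact: measurableC.
have pA0' : pr P (~` A0) = p by rewrite prC// pA0; lra.
have p1' : 1 - p <= 1 by rewrite lerBlDr lerDl ltW.
(* The pieces [B1] and [B2] give [B] conditional probability [1 - p] both on and off [A0]. *)
have [|B1 [mB1 B1A pB1]] := sierpinski atomlessP (t := (1 - p) * (1 - p)) mA0.
  by rewrite pA0 mulr_ge0 ?(ltW p1)//= ler_piMl// ltW.
have [|B2 [mB2 B2A pB2]] := sierpinski atomlessP (t := (1 - p) * p) mA0'.
  by rewrite pA0' mulr_ge0 ?(ltW p1) ?(ltW p0)//= ler_piMl// ltW.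
pose B := B1 `|` B2.
have mB : measurable B by exact: measurableU.
have disj : B1 `&` B2 = set0 by apply/seteqP; split=> // w [/B1A + /B2A].
have pB : pr P B = 1 - p by rewrite prU// pB1 pB2; ring.
pose Z w := c * \1_A0 w + delta * \1_B w.
have hZ : inL Z by apply: inLD; exact: inL_indic.
have ZE w : Lqf Z w = Z w by rewrite Lq_ofE.
have i1 (t : R) C : measurable C -> P.-integrable [set: T] (EFin \o (fun w => t * \1_C w)).
  by move=> mC; apply: integrable_mul_indic => //; exact: integrable_const.
have mZ : mean P (Lqf Z) = (1 - p) * (c + delta).
  rewrite Lq_ofE// meanD; [|exact: i1|exact: i1].
  by rewrite !meanZ ?mean_indic//; try exact: integrable_indic1; rewrite pA0 pB; ring.
have mZA : mean P (fun w => Lqf Z w * \1_A0 w) / (1 - p) = c + delta * (1 - p).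
  have -> : (fun w => Lqf Z w * \1_A0 w) = fun w => c * \1_A0 w + delta * \1_B1 w.
    apply/funext => w; rewrite ZE /Z indicU//; have [Aw|Aw] := pselect (A0 w).
      have B2w : (w \in B2) = false by apply: memNset => /B2A.
      by rewrite [\1_A0 w]indicE mem_set// [\1_B2 w]indicE B2w/= !mulr1 addr0.
    have B1w : (w \in B1) = false by apply: memNset => /B1A.
    by rewrite [\1_A0 w]indicE memNset// [\1_B1 w]indicE B1w/= !mulr0 addr0.
  rewrite meanD; [|exact: i1|exact: i1].
  rewrite !meanZ ?mean_indic//; try exact: integrable_indic1.
  by rewrite pA0 pB1; field; rewrite gt_eqF.
have := @risk_two_valued (Lqf Z) A0 c mA0 pA0.
rewrite mZ mZA => /(_ _ _) rZ.
(* The conditional means of [Z] on and off [A0] are [c + delta * (1 - p)] and [delta * (1 - p)]: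
   their gap is exactly [c]. *)
have <- : r Z = G c + (1 - p) * delta.
  rewrite /r rZ; first last.
  - move=> w Aw; rewrite ZE /Z [\1_A0 w]indicE memNset// mulr0 add0r indicE.
    by case: (_ \in _); rewrite ?mulr1 ?mulr0.
  - move=> w Aw; rewrite ZE /Z [\1_A0 w]indicE mem_set// mulr1 lerDl.
    by rewrite mulr_ge0// indicE.
  have -> : (c + delta * (1 - p) - (1 - p) * (c + delta)) / p = c.
    by field; rewrite gt_eqF.
  by rewrite /G; ring.
rewrite /G; have -> : (fun w => (c + delta) * \1_A0 w) =
    fun w => c * \1_A0 w + delta * \1_A0 w by apply/funext => w; rewrite mulrDl.
apply: (risk_concentrated mA0 pA0) => //.
- by apply: tail_on_side mA0 (@subset_refl _ A0); left.
- by apply: tail_on_side mA0 (@subset_refl _ A0); left.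
- exact: inL_indic.
- exact: inL_indic.
- by move=> C mC; apply: preimage_scaled_indic; rewrite ?pA0.
Qed.

Lemma profile_growth_pos c c' : 0 < c -> c <= c' ->
  (1 - p) * (c' - c) <= G c' - G c.
Proof.
move=> c0 cc'.
(* [profile_step] allows increments up to [c] only, so the interval is cut into [n] steps of length
   at most [c]. *)
pose n := (Num.bound ((c' - c) / c)).+1.
have n0 : (0 : R) < n%:R by rewrite ltr0n.
pose delta := (c' - c) / n%:R.
have d0 : 0 <= delta by rewrite divr_ge0 ?subr_ge0// ltW.
have dc : delta <= c.
  rewrite ler_pdivrMr// mulrC -ler_pdivrMr// ltW//.
  apply: lt_le_trans (archi_boundP _) _; first by rewrite divr_ge0 ?subr_ge0// ltW.
  by rewrite ler_nat.
have iter k : G c + (1 - p) * (k%:R * delta) <= G (c + k%:R * delta).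
  elim: k => [|k ih]; first by rewrite mul0r mulr0 !addr0.
  have kd : 0 <= k%:R * delta by rewrite mulr_ge0.
  have /profile_step : 0 <= delta <= c + k%:R * delta.
    by rewrite d0/=; lra.
  move=> h; rewrite -natr1 [(_ + 1) * delta]mulrDl mul1r [c + _]addrA; apply: le_trans h.
  by rewrite mulrDr addrA lerD2r.
have := iter n; have -> : n%:R * delta = c' - c.
  by rewrite /delta mulrC divfK// gt_eqF.
by rewrite [c + _]addrC subrK; lra.
Qed.

(** For [c = 0], the bound from a small positive [eps] is used, at a cost of at most [eps]. *)
Lemma profile_growth c c' : 0 <= c -> c <= c' ->
  (1 - p) * (c' - c) <= G c' - G c.
Proof.
rewrite le_eqVlt => /predU1P[<-|c0]; last exact: profile_growth_pos.
rewrite le_eqVlt => /predU1P[<-|c'0]; first by rewrite !subrr mulr0.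
rewrite subr0; apply/ler_addgt0Pr => e e0.
pose eps := Num.min e c'.
have eps0 : 0 < eps by rewrite lt_min e0.
have epse : eps <= e by rewrite ge_min lexx.
have epsc : eps <= c' by rewrite ge_min lexx orbT.
have h1 := profile_growth_pos eps0 epsc.
have h2 := profile_le (ltW eps0).
have h3 : (1 - p) * eps <= eps by rewrite ler_piMl ?(ltW eps0)// lerBlDr lerDl ltW.
rewrite mulrBr in h1; lra.
Qed.

End profile.

Lemma concentration_averse_mean_ES_form : rho 0 = 0 -> mean_ES_form p rho.
Proof.
move=> rho0.
have [|A0 [mA0 _ pA0]] := sierpinski atomlessP (t := 1 - p) (@measurableT _ T).
  by rewrite prT (ltW p1) lerBlDr lerDl ltW.
pose G c := r (fun w => c * \1_A0 w).
(* On nonnegative reals the slopes of [G] lie between [1 - p] and 1; rescaling by [1 / p] and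
   subtracting the slope [(1 - p) / p] leaves slopes between 0 and 1. *)
pose g x := G (x / p) - (1 - p) * (x / p).
have pneq0 : p != 0 by rewrite gt_eqF.
have gmono x y : 0 <= x -> x <= y -> 0 <= g y - g x.
  move=> x0 xy; have xp0 : 0 <= x / p by rewrite divr_ge0// ltW.
  have xyp : x / p <= y / p by rewrite ler_pM2r ?invr_gt0.
  by have := profile_growth mA0 pA0 xp0 xyp; rewrite -/(G _) -/(G _) /g mulrBr; lra.
have glip x y : x <= y -> g y - g x <= y - x.
  move=> xy; have xyp : x / p <= y / p by rewrite ler_pM2r ?invr_gt0.
  have := profile_lip mA0 xyp; rewrite -/(G _) -/(G _) /g => h.
  have -> : y - x = (y / p - x / p) - (1 - p) * (y / p - x / p) by field.
  by rewrite mulrBr; lra.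
exists g; split.
- move=> x y; rewrite !in_itv/= !andbT => x0 y0 xy.
  by rewrite -subr_ge0; exact: gmono.
- move=> x y; rewrite !in_itv/= !andbT => x0 y0.
  have [xy|/ltW xy] := leP x y.
    by rewrite [leLHS]distrC [leRHS]distrC !ger0_norm ?subr_ge0// ?glip// -subr_ge0 gmono.
  by rewrite !ger0_norm ?subr_ge0// ?glip// -subr_ge0 gmono.
- rewrite /g mul0r mulr0 subr0 /G /r -[RHS]rho0; congr rho.
  by apply/LfuneqP => w; rewrite Lq_ofE ?mul0r//; exact: inL_indic.
- move=> X; have iX := Lq_integrable X.
  have [A [mA pA AX XA]] := exists_tail atomlessP p01 X.
  have := risk_two_valued mA pA AX XA.
  rewrite (mean_tail_VaR p01 iX mA pA AX XA) [_ * ES _ _ _]mulrC mulfK ?gt_eqF//= => ->.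
  (* The tail event [A] depends on [X]; it is exchanged for the fixed [A0], the factor being
     nonnegative by [ES_ge_mean]. *)
  rewrite (risk_indic_law _ mA mA0 pA pA0); last first.
    by rewrite divr_ge0 ?(ltW p0)// subr_ge0 ES_ge_mean.
  by rewrite /g /G; ring.
Qed.
End concentration_averse.

Theorem proposition5 (d : measure_display) (T : measurableType d)
    (R : realType) (P : probability T R) (p q : R) (q1 : (1 <= q%:E)%E)
    (rho : LfunType P q1 -> R) :
  atomless P -> 0 < p < 1 -> Lq_continuous rho ->
  ([/\ monotone_risk rho, translation_invariant rho,
       concentration_averse p rho & rho 0 = 0]
   <-> mean_ES_form p rho)
  /\ (mean_ES_form p rho -> consistent_risk rho).
Proof.
move=> atomlessP p01 rhoC; split; first split.
- by move=> [rhoM rhoTI rhoCA rho0]; exact: concentration_averse_mean_ES_form.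
- exact: mean_ES_form_risk.
- move=> formE; have [rhoM rhoTI _ _] := mean_ES_form_risk atomlessP p01 formE.
  by split=> //; exact: (SSD_consistent_mean_ES atomlessP p01).
Qed.
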